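(* Let $\mu$ be a measure on $M_k$ and let $L:M_k\to M_k$ be measurable with $\int_{M_k}\|L(v)\|^2\,d\mu(v)<\infty$ and such that $\phi_L$ is irreducible and stochastic. Then there exists at least one probability $\nu$ on the Borel $\sigma$-algebra of $P(\mathbb{C}^k)$ that is invariant for the Markov operator $\Pi_L$, i.e. $\nu\Pi_L=\nu$.
   Context: $M_k$ is the set of complex $k\times k$ matrices with its Borel $\sigma$-algebra, $\dagger$ is the conjugate transpose; on $M_k$, $\|A\|=\sqrt{\operatorname{tr}(AA^\dagger)}$. For measurable $L:M_k\to M_k$ with $\int\|L(v)\|^2d\mu(v)<\infty$ put $\phi_L(\rho)=\int_{M_k}L(v)\rho L(v)^\dagger d\mu(v)$ on $M_k$. $\phi_L$ is irreducible if the only Hermitian projectors $P\in M_k$ with $\phi_L(PM_kP)\subset PM_kP$ are $P=0$ and $P=\mathrm{Id}$; $\phi_L$ is stochastic if $\int_{M_k}L(v)^\dagger L(v)\,d\mu(v)=\mathrm{Id}$. $P(\mathbb{C}^k)$ is the projective space of $\mathbb{C}^k$ with metric $d(\hat x,\hat y)=(1-|\langle x,y\rangle|^2)^{1/2}$, where $x,y$ are unit-norm representatives of $\hat x,\hat y$. For $A\in M_k$ with $Ax\neq0$, $A\cdot\hat x$ is the class of $Ax$ in $P(\mathbb{C}^k)$. For stochastic $\phi_L$, $\hat x\in P(\mathbb{C}^k)$ and Borel $S\subset P(\mathbb{C}^k)$, define $$\Pi_L(\hat x,S)=\int_{M_k}\mathbf 1_S(L(v)\cdot\hat x)\,\|L(v)x\|^2\,d\mu(v)$$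 (Euclidean norm on $\mathbb{C}^k$; the integrand is $0$ when $L(v)x=0$), and for a Borel probability $\nu$ on $P(\mathbb{C}^k)$ put $\nu\Pi_L(S)=\int_{P(\mathbb{C}^k)}\Pi_L(\hat x,S)\,d\nu(\hat x)$. *)

(* Defs.v *)
From HB Require Import structures.
From mathcomp Require Import all_boot all_order all_algebra.
From mathcomp Require Import complex.
From mathcomp Require Import all_classical all_reals all_analysis.

Set Implicit Arguments.
Unset Strict Implicit.
Unset Printing Implicit Defensive.

Import Order.TTheory GRing.Theory Num.Theory.
Import numFieldNormedType.Exports.

Local Open Scope classical_set_scope.
Local Open Scope ring_scope.
Local Open Scope sesquilinear_scope.

(* Typing R[i] as a numClosedFieldType is what gives it (and matrices over it) *)
(* the topology of the modulus and the conjugate transpose A ^t*.              *)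
Definition Cplx (R : realType) : numClosedFieldType := R[i].

(* Hilbert-Schmidt norm; on column vectors it is the Euclidean norm, since     *)
(* \tr (x x^t* ) = \sum_i |x_i|^2.                                             *)
Definition hsnorm (R : realType) (m n : nat) (A : 'M[Cplx R]_(m, n)) : R :=
  Num.sqrt (complex.Re (\tr (A *m A ^t*))).

Definition cdot (R : realType) (n : nat) (x y : 'cV[Cplx R]_n) : Cplx R :=
  (x ^t* *m y) 0 0.

Definition modulus (R : realType) (z : Cplx R) : R := complex.Re `|z|.

Section trmul.
Variable C : numClosedFieldType.

Lemma trmul_dotmx m n (A B : 'M[C]_(m, n)) :
  \tr (A *m B ^t*) = dotmx (mxvec A) (mxvec B).
Proof.
rewrite dotmxE mxE (reindex _ (curry_mxvec_bij m n)) /=.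
transitivity (\sum_i \sum_j A i j * (B i j)^*).
  by apply: eq_bigr => i _; rewrite mxE; apply: eq_bigr => j _; rewrite !mxE.
by rewrite pair_bigA; apply: eq_bigr => -[i j] _ /=; rewrite !mxE !mxvecE.
Qed.

Lemma trmul_ge0 m n (A : 'M[C]_(m, n)) : 0 <= \tr (A *m A ^t*).
Proof. by rewrite trmul_dotmx dnorm_ge0. Qed.

Lemma trmul_eq0 m n (A : 'M[C]_(m, n)) : \tr (A *m A ^t*) = 0 -> A = 0.
Proof.
rewrite trmul_dotmx => /eqP; rewrite dnorm_eq0 => /eqP AE.
by apply: (can_inj mxvecK); rewrite AE linear0.
Qed.

Lemma trmulZ m n (c : C) (A : 'M[C]_(m, n)) :
  \tr ((c *: A) *m (c *: A) ^t*) = `|c| ^+ 2 * \tr (A *m A ^t*).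
Proof. by rewrite !trmul_dotmx linearZ /= dnormZ. Qed.

Lemma trmul_triangle m n (A B : 'M[C]_(m, n)) :
  sqrtC (\tr ((A + B) *m (A + B) ^t*)) <=
  sqrtC (\tr (A *m A ^t*)) + sqrtC (\tr (B *m B ^t*)).
Proof.
rewrite !trmul_dotmx linearD /=; exact: (triangle_lerif _ _ _).1.
Qed.

Lemma trmul_tr n (x : 'cV[C]_n) : \tr (x *m x ^t*) = (x ^t* *m x) 0 0.
Proof. by rewrite mxtrace_mulC trace_mx11. Qed.

Lemma conj_cdot n (x y : 'cV[C]_n) : (y ^t* *m x) 0 0 = ((x ^t* *m y) 0 0)^*.
Proof.
rewrite !mxE rmorph_sum; apply: eq_bigr => i _.
by rewrite !mxE rmorphM /= conjCK mulrC.
Qed.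

Lemma proj_inj n (x y : 'cV[C]_n) : (x ^t* *m x) 0 0 = 1 ->
  x *m x ^t* = y *m y ^t* -> x = (y ^t* *m x) 0 0 *: y.
Proof.
move=> xx xy; rewrite -mul_mx_scalar -mx11_scalar mulmxA -xy -mulmxA.
by rewrite [x ^t* *m x]mx11_scalar xx mulmx1.
Qed.

(* The Hilbert-Schmidt distance of the projectors onto two lines is sqrt 2     *)
(* times the distance of the lines; the triangle inequality for pdist follows. *)
Lemma trmul_proj_sub n (x y : 'cV[C]_n) :
  (x ^t* *m x) 0 0 = 1 -> (y ^t* *m y) 0 0 = 1 ->
  \tr ((x *m x ^t* - y *m y ^t*) *m (x *m x ^t* - y *m y ^t*) ^t*) =
  2 * (1 - `|(x ^t* *m y) 0 0| ^+ 2).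
Proof.
move=> xx yy; have trC (u : 'cV[C]_n) : (u *m u ^t*) ^t* = u *m u ^t*.
  by rewrite trmx_mul map_mxM trmxCK.
have mulP (u v : 'cV[C]_n) :
    \tr ((u *m u ^t*) *m (v *m v ^t*)) = `|(u ^t* *m v) 0 0| ^+ 2.
  rewrite mulmxA -(mulmxA u) [u ^t* *m v]mx11_scalar mul_mx_scalar -scalemxAl.
  rewrite mxtraceZ mxtrace_mulC [v ^t* *m u]mx11_scalar mxtrace_scalar mulr1n.
  by rewrite (conj_cdot u v) -normCK !mxE.
have nC : `|(y ^t* *m x) 0 0| = `|(x ^t* *m y) 0 0|.
  by rewrite (conj_cdot x y) norm_conjC.
have tcB (U V : 'M[C]_n) : (U - V) ^t* = U ^t* - V ^t*.
  by apply/matrixP=> i j; rewrite !mxE rmorphB.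
rewrite tcB !trC mulmxBl !mulmxBr !raddfB /= !mulP nC xx yy normr1 expr1n.
by rewrite opprK [X in _ + X]addrC -mulr2n mulr_natl.
Qed.

End trmul.

Section hsnorm_theory.
Context {R : realType}.
Local Notation C := (Cplx R).
Local Notation "x %:RC" := (real_complex R x : C) (at level 2).

Lemma ReK (z : C) : 0 <= z -> (complex.Re z)%:RC = z.
Proof. by case: z => a b; rewrite lecE /= => /andP[/eqP -> _]. Qed.

Lemma Re_ge0 (z : C) : 0 <= z -> 0 <= complex.Re z.
Proof. by rewrite lecE /= => /andP[]. Qed.

Lemma modulusE (z : C) : (modulus z)%:RC = `|z|.
Proof. by rewrite ReK. Qed.

Lemma hsnorm_ge0 m n (A : 'M[C]_(m, n)) : 0 <= hsnorm A.
Proof. exact: sqrtr_ge0. Qed.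

Lemma sqr_hsnorm m n (A : 'M[C]_(m, n)) :
  ((hsnorm A) ^+ 2)%:RC = \tr (A *m A ^t*).
Proof. by rewrite sqr_sqrtr ?Re_ge0 ?ReK ?trmul_ge0. Qed.

Lemma hsnormE m n (A : 'M[C]_(m, n)) :
  (hsnorm A)%:RC = sqrtC (\tr (A *m A ^t*)).
Proof.
by rewrite -sqr_hsnorm rmorphXn /= sqrCK // ler0c hsnorm_ge0.
Qed.

Lemma hsnorm0 m n : hsnorm (0 : 'M[C]_(m, n)) = 0.
Proof. by rewrite /hsnorm mul0mx mxtrace0 sqrtr0. Qed.

Lemma hsnorm_eq0 m n (A : 'M[C]_(m, n)) : hsnorm A = 0 -> A = 0.
Proof.
by move=> A0; apply: trmul_eq0; rewrite -sqr_hsnorm A0 expr0n.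
Qed.

Lemma ler_hsnormD m n (A B : 'M[C]_(m, n)) :
  hsnorm (A + B) <= hsnorm A + hsnorm B.
Proof.
have := trmul_triangle A B; rewrite -!hsnormE.
by rewrite -(rmorphD (real_complex R)) lecR.
Qed.

Lemma ler_hsnorm_dist m n (B A D : 'M[C]_(m, n)) :
  hsnorm (A - D) <= hsnorm (A - B) + hsnorm (B - D).
Proof.
have -> : A - D = (A - B) + (B - D) by rewrite addrA subrK.
exact: ler_hsnormD.
Qed.

Lemma hsnormZ m n (c : C) (A : 'M[C]_(m, n)) :
  hsnorm (c *: A) = modulus c * hsnorm A.
Proof.
apply: complexI; rewrite hsnormE trmulZ -sqr_hsnorm -modulusE.
rewrite -rmorphXn -rmorphM -exprMn rmorphXn sqrCK //.
by rewrite ler0c mulr_ge0 ?hsnorm_ge0 // Re_ge0.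
Qed.

Lemma cdotxx n (x : 'cV[C]_n) : cdot x x = ((hsnorm x) ^+ 2)%:RC.
Proof. by rewrite sqr_hsnorm trmul_tr. Qed.

Lemma modulus_cdotC n (x y : 'cV[C]_n) :
  modulus (cdot y x) = modulus (cdot x y).
Proof. by rewrite /modulus /cdot conj_cdot norm_conjC. Qed.

Lemma hsnorm_proj_sub n (x y : 'cV[C]_n) : hsnorm x = 1 -> hsnorm y = 1 ->
  (hsnorm (x *m x ^t* - y *m y ^t*)) ^+ 2 = 2 * (1 - modulus (cdot x y) ^+ 2).
Proof.
move=> x1 y1; apply: complexI; rewrite sqr_hsnorm.
have xx : cdot x x = 1 by rewrite cdotxx x1 expr1n.
have yy : cdot y y = 1 by rewrite cdotxx y1 expr1n.
rewrite (trmul_proj_sub xx yy) -/(cdot x y) -modulusE.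
by rewrite rmorphM rmorphB rmorphXn rmorph1 rmorph_nat.
Qed.

End hsnorm_theory.

Section projective.
Variables (R : realType) (k : nat).
Local Notation C := (Cplx R).

(* Points are the lines of C^(k.+1); the dimension is a successor because      *)
(* C^0 has no line.                                                            *)
Definition projective := {U : {vspace 'cV[C]_k.+1} | \dim U == 1%N}.

HB.instance Definition _ := SubChoice.on projective.

Lemma line_subproof : \dim <[delta_mx ord0 ord0 : 'cV[C]_k.+1]>%VS == 1%N.
Proof.
rewrite dim_vline eqb1; apply/eqP => /matrixP/(_ ord0 ord0)/eqP.
by rewrite !mxE !eqxx oner_eq0.
Qed.

Definition proj0 : projective := Sub <[delta_mx ord0 ord0]>%VS line_subproof.

(* The class of x. The value at x = 0 is arbitrary: markov_kernel multiplies   *)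
(* it by the squared norm of x.                                                *)
Definition pclass (x : 'cV[C]_k.+1) : projective :=
  insubd proj0 <[x]>%VS.

HB.instance Definition _ := isPointed.Build projective proj0.

Lemma unit_repr (p : projective) :
  exists x : 'cV[C]_k.+1, hsnorm x = 1 /\ val p = <[x]>%VS.
Proof.
case: p => U dimU; set v := vpick U.
have v0 : v != 0 by rewrite vpick0 -dimv_eq0 (eqP dimU).
have h0 : hsnorm v != 0 by apply: contra v0 => /eqP/hsnorm_eq0/eqP.
pose c : C := real_complex R (hsnorm v)^-1.
have c0 : 0 <= c by rewrite ler0c invr_ge0 hsnorm_ge0.
exists (c *: v); split.
  by rewrite hsnormZ /modulus ger0_norm //= mulVf.
have cv0 : c *: v != 0.
  rewrite scaler_eq0 negb_or v0 andbT.
  by apply: contra h0 => /eqP/complexI/eqP; rewrite invr_eq0.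
apply/eqP; rewrite eq_sym eqEdim dim_vline cv0 (eqP dimU) andbT -memvE.
exact/memvZ/memv_pick.
Qed.

Definition prepr (p : projective) : 'cV[C]_k.+1 := sval (cid (unit_repr p)).

Lemma prepr_norm p : hsnorm (prepr p) = 1.
Proof. exact: (svalP (cid (unit_repr p))).1. Qed.

Lemma val_prepr p : val p = <[prepr p]>%VS.
Proof. exact: (svalP (cid (unit_repr p))).2. Qed.

Lemma prepr_neq0 p : prepr p != 0.
Proof.
apply/eqP => p0; have := prepr_norm p; rewrite p0 => /eqP.
by rewrite hsnorm0 eq_sym oner_eq0.
Qed.

Lemma preprK p : pclass (prepr p) = p.
Proof. by rewrite /pclass -val_prepr valKd. Qed.

Lemma val_pclass x : x != 0 -> val (pclass x) = <[x]>%VS.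
Proof. by move=> x0; rewrite insubdK // unfold_in /= dim_vline x0. Qed.

Definition pdist (p q : projective) : R :=
  Num.sqrt (1 - modulus (cdot (prepr p) (prepr q)) ^+ 2).

Let P (p : projective) := prepr p *m (prepr p) ^t*.

Lemma pdistE p q : pdist p q = hsnorm (P p - P q) / Num.sqrt 2.
Proof.
apply/eqP; rewrite -(@eqrXn2 _ 2) ?sqrtr_ge0 ?divr_ge0 ?sqrtr_ge0 ?hsnorm_ge0 //.
have H := hsnorm_proj_sub (prepr_norm p) (prepr_norm q).
rewrite expr_div_n /P H !sqr_sqrtr ?mulKf ?ler0n ?pnatr_eq0 //.
  by rewrite mulrAC divff ?mul1r ?pnatr_eq0.
by rewrite -(@pmulr_rge0 _ 2) ?ltr0n // -H sqr_ge0.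
Qed.

Lemma pdistxx p : pdist p p = 0.
Proof. by rewrite pdistE subrr hsnorm0 mul0r. Qed.

Lemma pdist_positivity p q : pdist p q = 0 -> p = q.
Proof.
rewrite pdistE => /eqP; rewrite mulf_eq0 invr_eq0 [Num.sqrt 2 == 0]sqrtr_eq0.
rewrite leNgt ltr0n orbF.
move=> /eqP/hsnorm_eq0/subr0_eq pq.
have pp : cdot (prepr p) (prepr p) = 1 by rewrite cdotxx prepr_norm expr1n.
have pE : val p = val q; last exact: val_inj.
have sub : (val p <= val q)%VS.
  rewrite !val_prepr -memvE (proj_inj pp pq).
  exact/memvZ/memv_line.
apply/eqP; rewrite eqEdim sub /=.
by case: {pq pp sub} p => U /= /eqP ->; case: q => V /= /eqP ->.
Qed.

Lemma pdist_sym p q : pdist p q = pdist q p.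
Proof. by rewrite /pdist (modulus_cdotC (prepr p) (prepr q)). Qed.

Lemma pdist_triangle q p r : pdist p r <= pdist p q + pdist q r.
Proof.
rewrite !pdistE -mulrDl ler_wpM2r ?invr_ge0 ?sqrtr_ge0 //.
exact: ler_hsnorm_dist.
Qed.

HB.instance Definition _ := isMetric.Build R projective
  pdistxx pdist_positivity pdist_sym pdist_triangle.

Definition pact (A : 'M[C]_k.+1) (p : projective) : projective :=
  pclass (A *m prepr p).

End projective.

Notation borel T := (g_sigma_algebraType (@open T)).

Section channel.
Context (R : realType) (k : nat).
Local Notation M := 'M[Cplx R]_k.+1.
Variables (mu : {measure set (borel M) -> \bar R}) (L : borel M -> borel M).

(* Entrywise integral; the real and imaginary parts are integrated separately. *)
Definition mxintegral (F : borel M -> M) : M :=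
  \matrix_(i, j) ((\int[mu]_v complex.Re (F v i j)) +i*
                  (\int[mu]_v complex.Im (F v i j)))%C.

Definition channel (rho : M) : M :=
  mxintegral (fun v => (L v : M) *m rho *m (L v : M) ^t*).

Definition stochastic : Prop :=
  mxintegral (fun v => (L v : M) ^t* *m (L v : M)) = 1%:M.

Definition hermitian_projector (P : M) : Prop := P ^t* = P /\ P *m P = P.

Definition corner (P : M) : set M := [set P *m A *m P | A in setT].

Definition irreducible_map (phi : M -> M) : Prop :=
  forall P : M, hermitian_projector P ->
    phi @` corner P `<=` corner P -> P = 0 \/ P = 1%:M.

Definition markov_kernel (x : projective R k) (S : set (projective R k)) : \bar R :=
  (\int[mu]_v (\1_S (pact (L v : M) x) *
               hsnorm ((L v : M) *m prepr x) ^+ 2)%:E)%E.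

Definition markov_push (nu : {measure set (borel (projective R k)) -> \bar R})
    (S : set (projective R k)) : \bar R :=
  (\int[nu]_x markov_kernel x S)%E.

End channel.

(* Main.v *)
Require Import Defs.
From HB Require Import structures.
From mathcomp Require Import all_boot all_order all_algebra.
From mathcomp Require Import complex.
From mathcomp Require Import all_classical all_reals all_analysis.
From mathcomp Require Import measurable_realfun ring lra.

Set Implicit Arguments.
Unset Strict Implicit.
Unset Printing Implicit Defensive.

Import Order.TTheory GRing.Theory Num.Theory.
Import numFieldNormedType.Exports.

Local Open Scope classical_set_scope.
Local Open Scope ring_scope.

(* Krylov-Bogoliubov. The transfer operator                                    *)
(*   (Pi f) x = \int f(L(v) x) |L(v) x|^2 dmu(v)                               *)
(* preserves the Lipschitz functions on the compact projective space: f(y)     *)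
(* |y|^2 is a function on C^(k+1) with increments O((|y| + |z|) |y - z|), so   *)
(* no dominated convergence is needed, only \int |L|^2 < oo. Stochasticity     *)
(* gives Pi 1 = 1. A limit along an ultrafilter of the Cesaro means of         *)
(* (Pi^j f) x0 is a normalized positive functional on the Lipschitz functions, *)
(* invariant under Pi; the Riesz representation theorem turns it into a        *)
(* probability nu with \int Pi f dnu = \int f dnu. Increasing Lipschitz        *)
(* approximations of the indicators of open sets and Dynkin's lemma extend     *)
(* the invariance to all Borel sets.                                           *)

(** * Lipschitz functions on a metric space *)

(** Projective space is compact ([projective_compact]) and the kernel has the Feller property, so
    averaging along the chain yields an invariant probability. The delicate point is the Feller
    property: [L v *m x] may vanish, and the class of 0 is arbitrary. The weight |L(v)x|^2 removes
    this singularity. The function [cone f], homogeneous of degree 2 in modulus, vanishes at 0 and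
    satisfies the estimate [quad] ([quad_cone]); integrated against the finite second moment of [L],
    it gives a Lipschitz function again ([lip_transfer]). Stochasticity enters as the total mass 1
    of the kernel ([channel_mass]).

    The rest holds on any compact metric space. [krylov_bogoliubov] builds the invariant functional,
    [riesz_lip] represents it by a probability on Lipschitz functions with values in [0, 1], and
    [weighted_system_invariant] passes from these to Borel sets. Lipschitz test functions suffice
    because the envelopes [lip_below] increase to the indicator of any open set. *)

#[short(type="pmetricType")]
HB.structure Definition PointedMetric (K : numDomainType) :=
  { T of Metric K T & Pointed T }.

Section lipschitz.
Context {R : realType} {T : pmetricType R}.
Implicit Types (f g : T -> R) (U : set T).

(** One-sided, since exchanging [x] and [y] gives the other bound. The sign of [K] is left free;
    [lip_ge0] restores it. *)
Definition lip f := exists K, forall x y, f x - f y <= K * mdist x y.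

Lemma lip_ge0 f : lip f ->
  exists2 K, 0 <= K & forall x y, f x - f y <= K * mdist x y.
Proof.
move=> [K fK]; exists `|K| => // x y; apply: le_trans (fK x y) _.
by rewrite ler_wpM2r ?mdist_ge0 ?ler_norm.
Qed.

Lemma lip_cst c : lip (fun=> c).
Proof. by exists 0 => x y /=; rewrite subrr mul0r. Qed.

Lemma lipD f g : lip f -> lip g -> lip (fun x => f x + g x).
Proof.
move=> [K fK] [K' gK]; exists (K + K') => x y /=.
by rewrite mulrDl opprD addrACA lerD ?fK ?gK.
Qed.

Lemma lipN f : lip f -> lip (fun x => - f x).
Proof. by move=> [K fK]; exists K => x y /=; rewrite opprK addrC metric_sym fK. Qed.

Lemma lipZ c f : lip f -> lip (fun x => c * f x).
Proof.
move=> [K fK]; have [c0|c0] := leP 0 c.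
  by exists (c * K) => x y /=; rewrite -mulrBr -mulrA ler_wpM2l ?fK.
exists (- c * K) => x y /=; rewrite -mulrBr -[leLHS]mulrNN -mulrA.
by rewrite ler_wpM2l ?oppr_ge0 ?(ltW c0)// opprB metric_sym fK.
Qed.

Lemma lip_sum n (F : nat -> T -> R) : (forall i, lip (F i)) ->
  lip (fun x => \sum_(i < n) F i x).
Proof.
move=> lF; elim: n => [|n ih].
  by under eq_fun do rewrite big_ord0; exact: lip_cst.
by under eq_fun do rewrite big_ord_recr/=; exact: lipD.
Qed.

Lemma lip_min f g : lip f -> lip g -> lip (fun x => Num.min (f x) (g x)).
Proof.
move=> /lip_ge0[K K0 fK] /lip_ge0[K' K'0 gK]; exists (K + K') => x y /=.
have d0 := mdist_ge0 x y.
have := fK x y; have := gK x y; have KK := mulr_ge0 K0 d0.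
have KK' := mulr_ge0 K'0 d0.
rewrite mulrDl minEle; case: ifPn => [|/negP]; rewrite minEle; case: ifPn; lra.
Qed.

Lemma lip_open f : lip f -> open [set x | 0 < f x].
Proof.
move=> /lip_ge0[K K0 fK]; rewrite openE => x /= fx0.
have K1 : 0 < K + 1 by rewrite ltr_wpDl.
(* [K + 1] rather than [K], because [K] may be 0. *)
apply/nbhs_ballP; exists (f x / (K + 1)); first by rewrite /= divr_gt0.
move=> y; rewrite ballEmdist /= ltr_pdivlMr// => xy.
have := fK x y; have := mdist_ge0 x y; nra.
Qed.

Lemma lip_open_lt f g : lip f -> lip g -> open [set x | f x < g x].
Proof.
move=> lf lg; have := lip_open (lipD lg (lipN lf)).
by under eq_set do rewrite subr_gt0.
Qed.

(* The Pasch-Hausdorff envelope: the largest n-Lipschitz function below \1_U.   *)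
Definition lip_below U (n : nat) x : R :=
  inf [set \1_U y + n%:R * mdist x y | y in setT].

Lemma lip_below_le_conv U n x y : lip_below U n x <= \1_U y + n%:R * mdist x y.
Proof.
apply: ge_inf; last by exists y.
by exists 0 => _ [z _ <-]; rewrite addr_ge0 ?mulr_ge0 ?mdist_ge0.
Qed.

Lemma le_lip_below U n x c :
  (forall y, c <= \1_U y + n%:R * mdist x y) -> c <= lip_below U n x.
Proof.
move=> h; apply: lb_le_inf => [|_ [y _ <-]//].
by exists (\1_U x + n%:R * mdist x x), x.
Qed.

Lemma lip_below_ge0 U n x : 0 <= lip_below U n x.
Proof. by apply: le_lip_below => y; rewrite addr_ge0 ?mulr_ge0 ?mdist_ge0. Qed.

Lemma lip_below_le U n x : lip_below U n x <= \1_U x.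
Proof. by have := lip_below_le_conv U n x x; rewrite mdistxx mulr0 addr0. Qed.

Lemma lip_below_nondecreasing U x :
  {homo lip_below U ^~ x : m n / (m <= n)%N >-> m <= n}.
Proof.
move=> m n mn; apply: le_lip_below => y.
apply: le_trans (lip_below_le_conv U m x y) _.
by rewrite lerD2l ler_wpM2r ?mdist_ge0 ?ler_nat.
Qed.

Lemma lip_lip_below U n : lip (lip_below U n).
Proof.
exists n%:R => x y /=; rewrite lerBlDr -lerBlDl.
apply: le_lip_below => z; rewrite lerBlDl.
apply: le_trans (lip_below_le_conv U n x z) _.
have := metric_triangle x y z; rewrite addrCA lerD2l -mulrDr.
by move=> h; rewrite ler_wpM2l.
Qed.

(** If the ball of radius r around x lies in U, a point y outside U costs at least n r in the
    infimum, which is at least 1 once n >= 1/r; a point inside U costs at least its indicator. *)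
Lemma lip_below_eq1 U x : open U -> U x ->
  exists N, forall n, (N <= n)%N -> lip_below U n x = 1.
Proof.
rewrite openE => /[apply] /nbhs_ballP[r /= r0 rU].
have U1 : \1_U x = 1 :> R by rewrite indicE mem_set//; apply: rU; exact: ballxx.
exists (Num.truncn r^-1).+1 => n rn; apply/eqP; rewrite eq_le.
rewrite -{1}U1 lip_below_le/=; apply: le_lip_below => y.
have [yU|yU] := pselect (U y).
  by rewrite indicE mem_set// lerDl mulr_ge0 ?mdist_ge0.
rewrite indicE memNset// add0r.
have xy : r <= mdist x y.
  by rewrite leNgt; apply/negP => xy; apply: yU; apply: rU; rewrite ballEmdist.
rewrite (le_trans _ (ler_wpM2l _ xy))//.
rewrite -ler_pdivrMr// mul1r ltW//.
by apply: lt_le_trans (truncnS_gt _) _; rewrite ler_nat.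
Qed.

End lipschitz.

(** * Dini's theorem and boundedness on a compact metric space *)

Section compact.
Context {R : realType} {T : pmetricType R}.
Hypothesis cT : compact [set: T].
Implicit Types (f g : T -> R) (U : set T).

(** The open sets where f < g n increase with n and cover the space; the largest index of a finite
    subcover works everywhere. *)
Lemma dini f (g : nat -> T -> R) : lip f -> (forall n, lip (g n)) ->
  (forall x, {homo g ^~ x : m n / (m <= n)%N >-> m <= n}) ->
  (forall x, exists n, f x < g n x) -> exists n, forall x, f x < g n x.
Proof.
move=> lf lg ndg fg; move: cT; rewrite compact_cover.
move=> /(_ nat setT (fun n => [set x | f x < g n x])).
case=> [n _|x _|D _ DT]; first exact: lip_open_lt.
  by have [n fgn] := fg x; exists n.
exists (\max_(i <- finmap.enum_fset D) i)%N => x.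
have [n /= nD fgn] := DT x Logic.I.
apply: lt_le_trans fgn (ndg _ _ _ _).
exact: (@leq_bigmax_seq _ _ xpredT id).
Qed.

Lemma lip_bounded f : lip f -> exists M, forall x, `|f x| <= M.
Proof.
have ub g : lip g -> exists M, 0 <= M /\ forall x, g x <= M.
  move=> lg; have [n gn] : exists n, forall x, g x < (fun (n : nat) (_ : T) => n%:R : R) n x.
    apply: dini lg (fun n => lip_cst _) _ _.
      by move=> x m n mn; rewrite ler_nat.
    by move=> x; exists (Num.truncn (g x)).+1; exact: truncnS_gt.
  by exists n%:R; split => // x; exact/ltW.
move=> lf; have [M [M0 fM]] := ub _ lf; have [M' [M'0 fM']] := ub _ (lipN lf).
exists (M + M') => x; have := fM x; have := fM' x.
by rewrite ler_norml; move=> ? ?; apply/andP; split; lra.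
Qed.

End compact.
(** * Riesz representation on a compact metric space *)

Section riesz.
Context {R : realType} {T : pmetricType R}.
Hypothesis cT : compact [set: T].
Implicit Types (f g : T -> R) (U V E : set T).

Variable Lam : (T -> R) -> R.
Hypothesis LamD : forall f g, lip f -> lip g ->
  Lam (fun x => f x + g x) = Lam f + Lam g.
Hypothesis LamZ : forall c f, lip f -> Lam (fun x => c * f x) = c * Lam f.
Hypothesis Lam_ge0 : forall f, lip f -> (forall x, 0 <= f x) -> 0 <= Lam f.
Hypothesis Lam1 : Lam (fun=> 1) = 1.

Let LamN f : lip f -> Lam (fun x => - f x) = - Lam f.
Proof.
by move=> lf; rewrite -mulN1r -LamZ//; congr Lam; apply/funext => x; rewrite mulN1r.
Qed.

Let Lam_cst c : Lam (fun=> c) = c.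
Proof.
rewrite -[RHS]mulr1 -[in RHS]Lam1 -LamZ; last exact: lip_cst.
by congr Lam; apply/funext => x; rewrite mulr1.
Qed.

Let le_Lam f g : lip f -> lip g -> (forall x, f x <= g x) -> Lam f <= Lam g.
Proof.
move=> lf lg fg; rewrite -subr_ge0 -LamN// -LamD//; last exact: lipN.
by apply: Lam_ge0 => [|x]; [exact/lipD/lipN|rewrite subr_ge0].
Qed.

Let Lam_sum n (F : nat -> T -> R) : (forall i, lip (F i)) ->
  Lam (fun x => \sum_(i < n) F i x) = \sum_(i < n) Lam (F i).
Proof.
move=> lF; elim: n => [|n ih].
  rewrite big_ord0 -[RHS](Lam_cst 0); congr Lam.
  by apply/funext => x; rewrite big_ord0.
rewrite big_ord_recr /= -ih -LamD//; last exact: lip_sum.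
by congr Lam; apply/funext => x; rewrite big_ord_recr.
Qed.

Let below U f := lip f /\ forall x, 0 <= f x <= \1_U x.

(** The Riesz construction: [inner] is the measure that open sets must receive, and [outer] extends
    it to all sets by outer regularity. *)
Let inner U : \bar R := ereal_sup [set (Lam f)%:E | f in below U].

Let outer E : \bar R := ereal_inf [set inner U | U in [set U | open U /\ E `<=` U]].

Let below_lip_below U n : below U (lip_below U n).
Proof. by split=> [|x]; [exact: lip_lip_below|rewrite lip_below_ge0 lip_below_le]. Qed.

Let le_inner U V : U `<=` V -> (inner U <= inner V)%E.
Proof.
move=> UV; apply: le_ereal_sup => _ [f [lf fU] <-]; exists f => //; split=> // x.
have /andP[-> /= fx] := fU x; apply: le_trans fx _.
rewrite !indicE ler_nat; case: (boolP (x \in U)) => // xU.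
by rewrite mem_set//; apply/UV/set_mem.
Qed.

Let Lam_le_inner U f : below U f -> ((Lam f)%:E <= inner U)%E.
Proof. by move=> fU; apply: ereal_sup_ubound; exists f. Qed.

Let inner_ge0 U : (0 <= inner U)%E.
Proof.
apply: le_trans (Lam_le_inner (below_lip_below U 0)).
by rewrite lee_fin Lam_ge0//; [exact: lip_lip_below|exact: lip_below_ge0].
Qed.

Let inner_le1 U : (inner U <= 1)%E.
Proof.
apply: ub_ereal_sup => _ [f [lf fU] <-]; rewrite lee_fin -Lam1.
apply: le_Lam => // [|x]; first exact: lip_cst.
by have /andP[_ /le_trans] := fU x; apply; rewrite indicE lern1 leq_b1.
Qed.

Let outer_ge0 E : (0 <= outer E)%E.
Proof. by apply/ereal_infP => _ [U _ <-]. Qed.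

Let le_outer : {homo outer : E F / E `<=` F >-> (E <= F)%E}.
Proof.
move=> E F EF; apply: le_ereal_inf => _ [U [oU FU] <-]; exists U => //; split=> //.
exact: subset_trans FU.
Qed.

Let outer_open U : open U -> outer U = inner U.
Proof.
move=> oU; apply/eqP; rewrite eq_le; apply/andP; split.
  by apply: ereal_inf_lbound; exists U => //; split.
by apply/ereal_infP => _ [V [oV UV] <-]; exact: le_inner.
Qed.

Let outer_le1 E : (outer E <= 1)%E.
Proof.
apply: (@le_trans _ _ (outer setT)); first exact: le_outer.
by rewrite outer_open ?inner_le1//; exact: openT.
Qed.

Let outer_fin E : outer E \is a fin_num.
Proof.
by rewrite ge0_fin_numE ?outer_ge0// (le_lt_trans (outer_le1 E))// ltry.
Qed.

Let outer0 : outer set0 = 0%E.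
Proof.
rewrite outer_open; last exact: open0.
apply/eqP; rewrite eq_le inner_ge0 andbT.
apply: ub_ereal_sup => _ [f [lf f0] <-]; rewrite lee_fin.
rewrite -(Lam_cst 0); apply: le_Lam => // [|x]; first exact: lip_cst.
by have /andP[_] := f0 x; rewrite indic0.
Qed.

(** By Dini, a function f below the union is dominated by e plus finitely many envelopes of the
    [U i]. A single index n serves both as the number of envelopes and as their slope, so that the
    bounding sequence is monotone in n. *)
Let inner_bigcup (U : (set T)^nat) : (forall n, open (U n)) ->
  (inner (\bigcup_n U n) <= \sum_(n <oo) inner (U n))%E.
Proof.
move=> oU; apply: ub_ereal_sup => _ [f [lf fU] <-].
apply/lee_addgt0Pr => e e0.
pose g n x := \sum_(i < n) lip_below (U i) n x + e.
have lg n : lip (g n).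
  apply: lipD (lip_cst _); apply: (@lip_sum _ _ n (fun i => lip_below (U i) n)).
  by move=> i; exact: lip_lip_below.
have [n fg] : exists n, forall x, f x < g n x.
  apply: dini => // [x m n mn|x].
    rewrite /g lerD2r -(subnKC mn) big_split_ord /=; apply: ler_wpDr.
      by apply: sumr_ge0 => i _; exact: lip_below_ge0.
    by apply: ler_sum => i _; exact/lip_below_nondecreasing/leq_addr.
  have /andP[_ fx] := fU x.
  have [[i _ Uix]|xU] := pselect ((\bigcup_n U n) x).
    have [N UN] := lip_below_eq1 (oU i) Uix.
    (* Large enough for the i-th envelope to occur in the sum and to equal 1 at x. *)
    exists (maxn i.+1 N).
    rewrite /g (bigD1 (Ordinal (leq_maxl i.+1 N)))//= UN ?leq_maxr//.
    apply: le_lt_trans fx _; rewrite indicE mem_set; last by exists i.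
    rewrite -addrA ltrDl ltr_wpDl// sumr_ge0// => j _.
    exact: lip_below_ge0.
  exists 0%N; rewrite /g big_ord0 add0r; apply: le_lt_trans fx _.
  by rewrite indicE memNset.
have : Lam f <= \sum_(i < n) Lam (lip_below (U i) n) + e.
  rewrite -(@Lam_sum n (fun i => lip_below (U i) n)); last by move=> i; exact: lip_lip_below.
  rewrite -[e in leRHS]Lam_cst -LamD; last exact: lip_cst.
    by apply: le_Lam => // [|x]; [exact: lg|exact/ltW/fg].
  by apply: (@lip_sum _ _ n (fun i => lip_below (U i) n)) => i; exact: lip_lip_below.
rewrite -lee_fin => /le_trans; apply; rewrite EFinD leeD2r// -sumEFin.
apply: (@le_trans _ _ (\sum_(i < n) inner (U i))%E).
  by apply: lee_sum => i _; apply: Lam_le_inner.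
rewrite -(big_mkord xpredT (fun i => inner (U i))).
by apply: nneseries_lim_ge => *; exact: inner_ge0.
Qed.

Let outer_sigma_subadditive : sigma_subadditive outer.
Proof.
move=> F; apply/lee_addgt0Pr => e e0.
have /choice[U UP] n : exists U, [/\ open U, F n `<=` U &
    (inner U <= outer (F n) + (e / (2 ^ n.+1)%:R)%:E)%E].
  have en : 0 < e / (2 ^ n.+1)%:R by rewrite divr_gt0// ltr0n expn_gt0.
  have [_ [U [oU FU] <-] UF] := lb_ereal_inf_adherent en (outer_fin (F n)).
  by exists U; split => //; exact: ltW.
apply: le_trans (epsilon_trick _ _ (ltW e0)) => //.
apply: (@le_trans _ _ (inner (\bigcup_n U n))).
  rewrite -outer_open; last by apply: bigcup_open => n _; have [] := UP n.
  by apply: le_outer; apply: subset_bigcup => n _; have [] := UP n.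
apply: le_trans (inner_bigcup _) _; first by move=> n; have [] := UP n.
by apply: lee_nneseries => // n _; have [] := UP n.
Qed.

HB.instance Definition _ := isOuterMeasure.Build R T outer
  outer0 outer_ge0 le_outer outer_sigma_subadditive.

(** Let V be an open set containing X and f a function below V [&] U. The open set W where f < e
    inside V contains V minus U, since f vanishes off U. If g is below W, then g vanishes where f >=
    e, so f + g <= 1 + e on V and (f + g) / (1 + e) is below V. Hence Lam f + Lam g <= (1 + e) inner
    V <= inner V + e, because inner V <= 1. *)
Let outer_caratheodory U : open U -> outer.-caratheodory U.
Proof.
move=> oU; apply: le_caratheodory_measurable => X.
apply/ereal_infP => _ [V [oV XV] <-].
apply: (@le_trans _ _ (outer (V `&` U) + outer (V `&` ~` U))%E).
  by apply: leeD; apply: le_outer; apply: setSI.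
rewrite outer_open; last exact: openI.
rewrite -leeBrDr//; apply: ub_ereal_sup => _ [f [lf fVU] <-].
rewrite leeBrDr//; apply/lee_addgt0Pr => e e0.
pose W := V `&` [set x | f x < e].
have oW : open W by apply: openI => //; apply: lip_open_lt => //; exact: lip_cst.
apply: (@le_trans _ _ ((Lam f)%:E + inner W)%E).
  rewrite leeD2l// -outer_open//; apply: le_outer => x [Vx Ux]; split=> //=.
  have /andP[_] := fVU x; rewrite indicE memNset; first by move=> /le_lt_trans; apply.
  by case.
rewrite addeC -leeBrDr//; apply: ub_ereal_sup => _ [g [lg gW] <-].
rewrite leeBrDr//.
have e1 : 0 < 1 + e by rewrite addr_gt0.
have bfg : below V (fun x => (1 + e)^-1 * (f x + g x)).
  split; first exact/lipZ/lipD.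
  move=> x; have /andP[f0 fx] := fVU x; have /andP[g0 gx] := gW x.
  rewrite mulr_ge0 ?invr_ge0 ?(ltW e1) ?addr_ge0//=.
  rewrite mulrC ler_pdivrMr//.
  have [Vx|Vx] := pselect (V x); last first.
    move: fx gx; rewrite !indicE !memNset /=; [lra|by []|by case|by case].
  move: fx gx; rewrite !indicE (mem_set Vx).
  have [fxe|fxe] := ltP (f x) e; last first.
    by rewrite (@memNset _ W)//; [case: (_ \in _) => /=; lra|move=> [_ /=]; lra].
  rewrite (@mem_set _ W)// => _ /=; lra.
have := Lam_le_inner bfg; rewrite LamZ ?LamD//; last exact: lipD.
have V1 : (inner V <= 1)%E := inner_le1 V; move: V1 (inner_ge0 V).
case: (inner V) => [v| |]//; rewrite !lee_fin => v1 v0.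
rewrite mulrC ler_pdivrMr//; nra.
Qed.

Let open_caratheodory : @measurable _ (borel T) `<=` outer.-caratheodory.
Proof.
apply: smallest_sub; last by move=> U; exact: outer_caratheodory.
split; first exact: caratheodory_measurable_set0.
  by move=> A; rewrite setTD; exact: caratheodory_measurable_setC.
by move=> F; exact: caratheodory_measurable_bigcup.
Qed.

Let nu (A : set (borel T)) : \bar R := outer A.

Let nu_sigma_additive : semi_sigma_additive nu.
Proof.
move=> F mF tF mUF; apply: (@caratheodory_measure_sigma_additive R T outer) => //.
- by move=> i; exact: open_caratheodory.
- exact: open_caratheodory.
Qed.

HB.instance Definition _ := isMeasure.Build _ (borel T) R nu
  outer0 outer_ge0 nu_sigma_additive.

Let nuT : nu setT = 1%E.
Proof.
apply/eqP; rewrite eq_le outer_le1 /= /nu outer_open; last exact: openT.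
have <- : (Lam (fun=> 1))%:E = 1%E by rewrite Lam1.
apply: Lam_le_inner; split=> [|x]; first exact: lip_cst.
by rewrite indicT ler01 lexx.
Qed.

HB.instance Definition _ := Measure_isProbability.Build _ (borel T) R nu nuT.

(** This single inequality on open sets is all that is kept of the construction: slicing turns it
    into Lam f <= \int f, and passing to 1 - f then forces equality. *)
Lemma riesz_probability : exists nu : probability (borel T) R,
  forall U f, open U -> lip f -> (forall x, 0 <= f x <= \1_U x) ->
    ((Lam f)%:E <= nu U)%E.
Proof.
exists nu => U f oU lf fU; rewrite [leRHS]outer_open//.
by apply: Lam_le_inner.
Qed.

End riesz.

Lemma open_borel {T : ptopologicalType} (U : set T) :
  open U -> measurable (U : set (borel T)).
Proof. exact: sub_sigma_algebra. Qed.

Lemma lower_open_measurable {R : realType} {T : ptopologicalType} (f : T -> R) :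
  (forall a, open [set x | a < f x]) ->
  measurable_fun [set: borel T] (f : borel T -> R).
Proof.
move=> fo; apply: (measurability _ (RGenOInfty.measurableE R)) => //.
move=> _ [_ [a ->] <-]; rewrite setTI; apply: sub_sigma_algebra.
by rewrite preimage_itvoy; exact: fo.
Qed.

(** * Comparing the functional with the integral *)

Section lip_integral.
Context {R : realType} {T : pmetricType R}.
Implicit Types (f g : T -> R) (U V E : set T).

Lemma lip_measurable f : lip f -> measurable_fun [set: borel T] (f : borel T -> R).
Proof.
by move=> lf; apply: lower_open_measurable => a; apply: lip_open_lt => //; exact: lip_cst.
Qed.

Variable nu : probability (borel T) R.

Lemma lip_integral_fin f : lip f -> (forall x, 0 <= f x <= 1) ->
  (\int[nu]_x (f x)%:E \is a fin_num)%E.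
Proof.
move=> lf f01; rewrite ge0_fin_numE; last first.
  by apply: integral_ge0 => x _; rewrite lee_fin; have /andP[] := f01 x.
apply: (@le_lt_trans _ _ (\int[nu]_x (cst 1 x)))%E; last first.
  by rewrite integral_cst//= mul1e probability_setT ltry.
apply: ge0_le_integral => //.
- by move=> x _; rewrite lee_fin; have /andP[] := f01 x.
- by apply/measurable_EFinP; exact: lip_measurable.
- by move=> x _; rewrite lee_fin; have /andP[] := f01 x.
Qed.

Section le_integral.
Variable Lam : (T -> R) -> R.
Hypothesis LamD : forall f g, lip f -> lip g ->
  Lam (fun x => f x + g x) = Lam f + Lam g.
Hypothesis LamZ : forall c f, lip f -> Lam (fun x => c * f x) = c * Lam f.
Hypothesis Lam1 : Lam (fun=> 1) = 1.
Hypothesis Lam_nu : forall U f, open U -> lip f ->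
  (forall x, 0 <= f x <= \1_U x) -> ((Lam f)%:E <= nu U)%E.

Let Lam_sum n (F : nat -> T -> R) : (forall i, lip (F i)) ->
  Lam (fun x => \sum_(i < n) F i x) = \sum_(i < n) Lam (F i).
Proof.
move=> lF; elim: n => [|n ih].
  rewrite big_ord0 -[RHS](mul0r (Lam (fun=> 1))) -LamZ; last exact: lip_cst.
  by congr Lam; apply/funext => x; rewrite big_ord0 mul0r.
rewrite big_ord_recr /= -ih -LamD//; last exact: lip_sum.
by congr Lam; apply/funext => x; rewrite big_ord_recr.
Qed.

(* Slice [n f] into its parts [f_i] between the levels [i] and [i + 1]: then   *)
(* [f_(i+1) <= 1_{n f > i+1} <= f_i].                                          *)
Lemma le_Lam_integral f : lip f -> (forall x, 0 <= f x <= 1) ->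
  ((Lam f)%:E <= \int[nu]_x (f x)%:E)%E.
Proof.
move=> lf f01; rewrite -(fineK (lip_integral_fin lf f01)) lee_fin.
set I := fine _.
(* The error 1 does not grow with n, so dividing by a large n rules out I < Lam f. *)
suff key n : n%:R * Lam f <= 1 + n%:R * I.
  rewrite leNgt; apply/negP => If; have d0 : 0 < Lam f - I by rewrite subr_gt0.
  have := truncnS_gt (Lam f - I)^-1; set n := _.+1 => nI.
  have := key n; apply/negP; rewrite -ltNge -ltrBrDr -mulrBr.
  by rewrite -ltr_pdivrMr// mul1r.
pose F (i : nat) x := Num.min (n%:R * f x) i.+1%:R - Num.min (n%:R * f x) i%:R.
have lm i : lip (fun x => Num.min (n%:R * f x) i%:R).
  by apply: lip_min; [exact: lipZ|exact: lip_cst].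
have lF i : lip (F i) by apply: lipD; [exact: lm|apply: lipN; exact: lm].
have F01 i x : 0 <= F i x <= 1.
  rewrite /F -natr1 !minEle.
  by case: ifPn => [|/negP]; case: ifPn => [|/negP]; move=> *; apply/andP; lra.
have sumF x : \sum_(i < n) F i x = n%:R * f x.
  have /andP[f0 f1] := f01 x.
  rewrite -(big_mkord xpredT (F ^~ x)) /F telescope_sumr//.
  rewrite min_l; last by rewrite -[leRHS]mulr1 ler_wpM2l.
  by rewrite min_r ?subr0// mulr_ge0.
have FU i x : F i x <= \1_[set x | i%:R < n%:R * f x] x.
  rewrite indicE; case: (boolP (_ \in _)) => [_|]; first by have /andP[] := F01 i x.
  rewrite notin_setE /= => /negP; rewrite -leNgt => fi.
  rewrite /F !min_l ?subrr//; apply: le_trans fi _; by rewrite ler_nat.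
have UF i x : \1_[set x | i.+1%:R < n%:R * f x] x <= F i x.
  rewrite indicE; case: (boolP (_ \in _)) => [|_]; last by have /andP[] := F01 i x.
  rewrite inE /= => fi.
  rewrite /F !min_r; last exact: ltW.
    by rewrite -natrB ?leqnSn// subSnn.
  by apply/ltW; apply: le_lt_trans fi; rewrite ler_nat.
have oU i : open [set x | i%:R < n%:R * f x].
  by apply: lip_open_lt; [exact: lip_cst|exact: lipZ].
have mF i : measurable_fun [set: borel T] (F i : borel T -> R) by exact: lip_measurable.
have F0 i x : (0 <= (F i x)%:E)%E by rewrite lee_fin; have /andP[] := F01 i x.
(* The lowest slice has no slice beneath it to compare with; the total mass bounds it, and this is
   the error 1. *)
have LF0 : ((Lam (F 0%N))%:E <= 1)%E.
  apply: (@le_trans _ _ (nu setT)); last by rewrite probability_setT.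
  apply: Lam_nu => //; first exact: openT.
  by move=> x; rewrite indicT; exact: F01.
have LF i : ((Lam (F i.+1))%:E <= \int[nu]_x (F i x)%:E)%E.
  apply: (@le_trans _ _ (nu [set x | i.+1%:R < n%:R * f x])).
    apply: Lam_nu => // x; rewrite FU andbT; by have /andP[] := F01 i.+1 x.
  rewrite -[X in nu X]setIT -integral_indic//; last exact: open_borel.
  apply: ge0_le_integral => //.
  - by apply/measurable_EFinP/measurable_indic; exact: open_borel.
  - by apply/measurable_EFinP; exact: mF.
  - by move=> x _; rewrite lee_fin UF.
have LFn m : ((\sum_(i < m) Lam (F i))%:E <=
              1 + \sum_(i < m) \int[nu]_x (F i x)%:E)%E.
  case: m => [|m]; first by rewrite !big_ord0 adde0 lee_fin.
  rewrite big_ord_recl EFinD leeD// -sumEFin.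
  rewrite big_ord_recr /= -[leLHS]adde0 leeD//; first by apply: lee_sum.
  by apply: integral_ge0.
have := LFn n; rewrite -(Lam_sum _ lF).
under eq_fun do rewrite sumF; rewrite LamZ// -ge0_integral_sum//;
  last by move=> i; apply/measurable_EFinP; exact: mF.
under eq_integral do rewrite sumEFin sumF EFinM.
rewrite ge0_integralZl_EFin//; last 2 first.
- by move=> x _; rewrite lee_fin; have /andP[] := f01 x.
- by apply/measurable_EFinP; exact: lip_measurable.
by rewrite -(fineK (lip_integral_fin lf f01)) -EFinM -EFinD lee_fin.
Qed.

End le_integral.

End lip_integral.

Theorem riesz_lip {R : realType} {T : pmetricType R} (Lam : (T -> R) -> R) :
  compact [set: T] ->
  (forall f g, lip f -> lip g -> Lam (fun x => f x + g x) = Lam f + Lam g) ->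
  (forall c f, lip f -> Lam (fun x => c * f x) = c * Lam f) ->
  (forall f, lip f -> (forall x, 0 <= f x) -> 0 <= Lam f) ->
  Lam (fun=> 1) = 1 ->
  exists nu : probability (borel T) R, forall f, lip f ->
    (forall x, 0 <= f x <= 1) -> (\int[nu]_x (f x)%:E)%E = (Lam f)%:E.
Proof.
move=> cT LamD LamZ Lam0 Lam1.
have [nu nuU] := riesz_probability cT LamD LamZ Lam0 Lam1.
exists nu => f lf f01; apply/eqP; rewrite eq_le le_Lam_integral// andbT.
(* The reverse inequality comes from applying [le_Lam_integral] to 1 - f, since both sides give mass
   1 to the constant 1. *)
have lf' : lip (fun x => 1 + -1 * f x) by apply: lipD; [exact: lip_cst|exact: lipZ].
have f01' x : 0 <= 1 + -1 * f x <= 1 by have /andP[] := f01 x; move=> *; apply/andP; lra.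
have := le_Lam_integral LamD LamZ nuU lf' f01'.
rewrite LamD; [|exact: lip_cst|exact: lipZ].
rewrite LamZ// Lam1.
have -> : (\int[nu]_x (1 + -1 * f x)%:E = 1 - \int[nu]_x (f x)%:E)%E.
  have fi : nu.-integrable [set: borel T] (EFin \o f).
    apply/integrableP; split; first by apply/measurable_EFinP; exact: lip_measurable.
    under eq_integral => x _ do rewrite /= ger0_norm ?(andP (f01 x)).1//.
    rewrite -ge0_fin_numE ?lip_integral_fin//; apply: integral_ge0 => x _.
    by rewrite lee_fin; have /andP[] := f01 x.
  rewrite -[X in (X - _)%E](@probability_setT _ _ _ nu) -[X in (X - _)%E]mul1e.
  rewrite -(integral_cst nu measurableT 1) -integralB_EFin//.
    by apply: eq_integral => x _; rewrite mulN1r.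
  by apply/finite_measure_integrable_cst.
rewrite -(fineK (lip_integral_fin nu lf f01)) -EFinB !lee_fin; lra.
Qed.

(** * Invariant probabilities *)

Lemma ultra_fmap {T U : Type} (f : T -> U) (F : set_system T) :
  UltraFilter F -> UltraFilter (f @ F).
Proof.
move=> FU; split=> [|G GF sFG]; first exact: fmap_proper_filter.
apply/seteqP; split=> // A GA.
have [//|FnA] := in_ultra_setVsetC (f @^-1` A) FU.
have GnA : G (~` A) by exact: sFG.
by have /filter_ex[? []] : G (A `&` ~` A) by exact: filterI.
Qed.

(** An ultrafilter makes all bounded functions converge at once, with no extraction of subsequences;
    this is what makes the limit of the Cesaro means linear in the test function. *)
Lemma bounded_ultra_cvg {R : realType} {T : Type} (u : T -> R) M (F : set_system T) :
  UltraFilter F -> (forall t, `|u t| <= M) -> cvg (u @ F).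
Proof.
move=> FU uM; have := @segment_compact R (- M) M.
rewrite compact_ultra => /(_ _ (ultra_fmap u FU)).
case=> [|l [_ ul]]; last by apply/cvg_ex; exists l.
apply: (@filterS _ F _ setT); last exact: filterT.
by move=> t _ /=; rewrite in_itv /= -ler_norml.
Qed.

Section krylov_bogoliubov.
Context {R : realType} {T : pmetricType R}.
Hypothesis cT : compact [set: T].
Implicit Types f g : T -> R.

Variable Pi : (T -> R) -> T -> R.
Hypothesis Pi_lip : forall f, lip f -> lip (Pi f).
Hypothesis PiD : forall f g x, lip f -> lip g ->
  Pi (fun x => f x + g x) x = Pi f x + Pi g x.
Hypothesis PiZ : forall c f x, lip f -> Pi (fun x => c * f x) x = c * Pi f x.
Hypothesis Pi_ge0 : forall f x, lip f -> (forall y, 0 <= f y) -> 0 <= Pi f x.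
Hypothesis Pi1 : forall x, Pi (fun=> 1) x = 1.

Let it j f := iter j Pi f.

Let it_lip j f : lip f -> lip (it j f).
Proof. by move=> lf; elim: j => //= j; exact: Pi_lip. Qed.

Let itD j f g x : lip f -> lip g -> it j (fun x => f x + g x) x = it j f x + it j g x.
Proof.
move=> lf lg; elim: j x => //= j ih x; rewrite -PiD; [|exact: it_lip..].
by congr (Pi _ x); apply/funext.
Qed.

Let itZ j c f x : lip f -> it j (fun x => c * f x) x = c * it j f x.
Proof.
move=> lf; elim: j x => //= j ih x; rewrite -PiZ; last exact: it_lip.
by congr (Pi _ x); apply/funext.
Qed.

Let it_ge0 j f x : lip f -> (forall y, 0 <= f y) -> 0 <= it j f x.
Proof.
by move=> lf f0; elim: j x => //= j ih x; apply: Pi_ge0 => //; exact: it_lip.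
Qed.

Let it1 j x : it j (fun=> 1) x = 1.
Proof.
elim: j x => //= j ih x; rewrite -[RHS](Pi1 x).
by congr (Pi _ x); apply/funext.
Qed.

Let it_le j f M x : lip f -> (forall y, f y <= M) -> it j f x <= M.
Proof.
move=> lf fM; have lM : lip (fun x => M * 1 + -1 * f x).
  by apply: lipD; [exact: lip_cst|exact: lipZ].
have : 0 <= it j (fun x => M * 1 + -1 * f x) x.
  by apply: it_ge0 => // y; rewrite mulr1 mulN1r subr_ge0.
rewrite itD; [|exact: lip_cst|exact: lipZ].
rewrite !itZ ?it1; [lra|by []|exact: lip_cst].
Qed.

Let it_norm_le j f M x : lip f -> (forall y, `|f y| <= M) -> `|it j f x| <= M.
Proof.
move=> lf fM; rewrite ler_norml -lerN2 opprK andbC it_le//=; last first.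
  by move=> y; exact: le_trans (ler_norm _) (fM y).
rewrite -mulN1r -itZ//; apply: it_le; first exact: lipZ.
by move=> y; rewrite mulN1r; apply: le_trans (ler_norm _) _; rewrite normrN.
Qed.

Let mean f n := n.+1%:R^-1 * \sum_(j < n.+1) it j f point.

Let mean_norm_le f M n : lip f -> (forall y, `|f y| <= M) -> `|mean f n| <= M.
Proof.
move=> lf fM; rewrite normrM gtr0_norm ?invr_gt0// mulrC ler_pdivrMr//.
apply: le_trans (ler_norm_sum _ _ _) _.
apply: (@le_trans _ _ (\sum_(j < n.+1) M)).
  by apply: ler_sum => j _; exact: it_norm_le.
by rewrite sumr_const card_ord mulr_natr.
Qed.

Lemma krylov_bogoliubov : exists nu : probability (borel T) R,
  forall f, lip f -> (forall x, 0 <= f x <= 1) ->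
    (\int[nu]_x (Pi f x)%:E = \int[nu]_x (f x)%:E)%E.
Proof.
have [U [UU ooU]] := @ultraFilterLemma nat \oo _.
have cm f : lip f -> cvg (mean f @ U).
  move=> lf; have [M fM] := lip_bounded cT lf.
  by apply: (bounded_ultra_cvg UU) => n; exact: mean_norm_le fM.
pose Lam f : R := lim (mean f @ U).
have LamE f l : mean f @ U --> l -> Lam f = l by exact: cvg_lim.
have LamD f g : lip f -> lip g -> Lam (fun x => f x + g x) = Lam f + Lam g.
  move=> lf lg; apply: LamE.
  rewrite (_ : mean _ = mean f \+ mean g); first by apply: cvgD; exact: cm.
  apply/funext => n /=; rewrite /mean -mulrDr -big_split /=.
  by congr (_ * _); apply: eq_bigr => j _; rewrite itD.
have LamZ c f : lip f -> Lam (fun x => c * f x) = c * Lam f.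
  move=> lf; apply: LamE.
  rewrite (_ : mean _ = fun n => c * mean f n); first by apply: cvgMr; exact: cm.
  apply/funext => n /=; rewrite /mean mulrCA; congr (_ * _).
  by rewrite mulr_sumr; apply: eq_bigr => j _; rewrite itZ.
have Lam_ge0 f : lip f -> (forall x, 0 <= f x) -> 0 <= Lam f.
  move=> lf f0; apply: limr_ge; first exact: cm.
  near=> n; rewrite mulr_ge0 ?invr_ge0// sumr_ge0// => j _; exact: it_ge0.
have Lam1 : Lam (fun=> 1) = 1.
  apply: LamE; rewrite (_ : mean _ = cst 1); first exact: cvg_cst.
  apply/funext => n; rewrite /mean; under eq_bigr do rewrite it1.
  by rewrite sumr_const card_ord mulVf ?pnatr_eq0.
have [nu nuE] := riesz_lip cT LamD LamZ Lam_ge0 Lam1.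
exists nu => f lf f01; rewrite !nuE//; last 2 first.
- exact: Pi_lip.
(* Riesz identifies the integral only for functions with values in [0, 1], and Pi preserves this
   range. *)
- move=> x; rewrite Pi_ge0//=; last by move=> y; have /andP[] := f01 y.
  by apply: (@it_le 1%N) => // y; have /andP[] := f01 y.
congr EFin; apply/eqP; rewrite -subr_eq0; apply/eqP.
rewrite -mulN1r -LamZ// -LamD; [|exact: Pi_lip|exact: lipZ].
apply: LamE; apply: cvg_trans (cvg_fmap2 ooU) _.
(* The mean of Pi f - f telescopes, leaving two terms bounded by M over n + 1. This tends to 0 along
   \oo, hence along the finer ultrafilter. *)
suff -> : mean (fun x => Pi f x + -1 * f x) =
    fun n => n.+1%:R^-1 * (it n.+1 f point - f point).
  have [M fM] := lip_bounded cT lf.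
  apply/cvgr0Pnorm_le => e e0.
  near=> n; rewrite normrM gtr0_norm ?invr_gt0// mulrC ler_pdivrMr//.
  apply: (@le_trans _ _ (M + M)).
    by apply: le_trans (ler_normB _ _) _; apply: lerD => //; exact: it_norm_le.
  rewrite mulrC -ler_pdivrMr//; apply: (@le_trans _ _ n%:R); last by rewrite ler_nat.
  by near: n; exact: nbhs_infty_ger.
apply/funext => n; rewrite /mean; congr (_ * _).
rewrite -(big_mkord xpredT (fun j => it j _ point)).
rewrite -(@telescope_sumr _ 0 n.+1 (fun j => it j f point))//.
apply: eq_bigr => j _; rewrite itD; [|exact: Pi_lip|exact: lipZ].
by rewrite itZ// mulN1r /it iterSr.
Unshelve. all: by end_near.
Qed.

End krylov_bogoliubov.

Lemma cvg_integral_nondecreasing d {X : measurableType d} {R : realType}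
    (m : {measure set X -> \bar R}) (g : (X -> \bar R)^nat) (f : X -> \bar R) :
  (forall n, measurable_fun setT (g n)) -> (forall n x, (0 <= g n x)%E) ->
  (forall x, {homo g ^~ x : i j / (i <= j)%N >-> (i <= j)%E}) ->
  (forall x, g n x @[n --> \oo] --> f x) ->
  (\int[m]_x g n x @[n --> \oo] --> \int[m]_x f x)%E.
Proof.
move=> mg g0 ndg gf.
rewrite (_ : f = fun x => limn (g ^~ x)); last first.
  by apply/funext => x; apply/esym/cvg_lim => //; exact: gf.
by apply: cvg_monotone_convergence => // x _; exact: ndg.
Qed.

(** * Invariant probability of a weighted family of maps on a compact metric space *)

Section weighted_system.
Context d (V : measurableType d) (R : realType) (T : pmetricType R).
Hypothesis cT : compact [set: T].
Variables (mu : {measure set V -> \bar R}) (a : V -> T -> T) (w : V -> T -> R).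
Implicit Types (f g : T -> R) (x : T).
Hypothesis mA : forall x, measurable_fun setT (a ^~ x : V -> borel T).
Hypothesis mw : forall x, measurable_fun setT (w ^~ x).
Hypothesis w0 : forall v x, 0 <= w v x.
Hypothesis w1 : forall x, (\int[mu]_v (w v x)%:E = 1)%E.

Let Pi f x := \int[mu]_v (f (a v x) * w v x).

Hypothesis Pi_lip : forall f, lip f -> lip (Pi f).

Let kap x (S : set T) : \bar R := (\int[mu]_v (\1_S (a v x) * w v x)%:E)%E.

Let m_fw f x : measurable_fun [set: borel T] (f : borel T -> R) ->
  measurable_fun setT (fun v => f (a v x) * w v x).
Proof.
move=> mf; apply: measurable_funM (mw x).
exact: (measurableT_comp mf (mA x)).
Qed.

Let w_int x : mu.-integrable setT (EFin \o w ^~ x).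
Proof.
apply/integrableP; split; first exact/measurable_EFinP.
under eq_integral => v _ do rewrite /= ger0_norm ?w0//.
by rewrite w1 ltry.
Qed.

Let fw_int f x : lip f -> mu.-integrable setT (EFin \o fun v => f (a v x) * w v x).
Proof.
move=> lf; have [M fM] := lip_bounded cT lf.
apply: (@le_integrable _ _ _ _ _ _ _ (fun v => M%:E * (w v x)%:E)%E) => //.
- by apply/measurable_EFinP; apply: m_fw; exact: lip_measurable.
- move=> v _; rewrite -EFinM /= lee_fin !normrM ler_wpM2r//.
  exact: le_trans (fM _) (ler_norm _).
- exact: integrableZl (w_int x).
Qed.

Let PiE f x : lip f -> (\int[mu]_v (f (a v x) * w v x)%:E = (Pi f x)%:E)%E.
Proof.
by move=> lf; rewrite /Pi /Rintegral fineK//; apply: integrable_fin_num => //; exact: fw_int.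
Qed.

Let PiD f g x : lip f -> lip g -> Pi (fun x => f x + g x) x = Pi f x + Pi g x.
Proof.
move=> lf lg; rewrite -RintegralD//; [|exact: fw_int..].
by apply: eq_Rintegral => v _; rewrite mulrDl.
Qed.

Let PiZ c f x : lip f -> Pi (fun x => c * f x) x = c * Pi f x.
Proof.
move=> lf; rewrite -RintegralZl//; last exact: fw_int.
by apply: eq_Rintegral => v _; rewrite mulrA.
Qed.

Let Pi_ge0 f x : lip f -> (forall y, 0 <= f y) -> 0 <= Pi f x.
Proof. by move=> lf f0; apply: Rintegral_ge0 => v _; rewrite mulr_ge0. Qed.

Let Pi1 x : Pi (fun=> 1) x = 1.
Proof.
rewrite /Pi; under eq_Rintegral do rewrite mul1r.
by rewrite /Rintegral w1.
Qed.

Let le_Pi f g x : lip f -> lip g -> (forall y, f y <= g y) -> Pi f x <= Pi g x.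
Proof.
move=> lf lg fg; rewrite -subr_ge0 -mulN1r -PiZ// -PiD//; last exact: lipZ.
apply: Pi_ge0 => [|y]; first by apply: lipD => //; exact: lipZ.
by rewrite mulN1r subr_ge0.
Qed.

(** In this form additivity in S is additivity of the integral over disjoint preimages. *)
Let kap_setE x (S : set (borel T)) : measurable S ->
  kap x S = (\int[mu]_(v in (a ^~ x) @^-1` S) (w v x)%:E)%E.
Proof.
move=> mS; rewrite integral_mkcond; apply: eq_integral => v _.
rewrite patchE /= indicE.
have -> : (v \in (a ^~ x) @^-1` S) = (a v x \in S) by apply/idP/idP; rewrite !inE.
by case: (_ \in _); rewrite ?mul1r ?mul0r.
Qed.

Let m_pre x (S : set (borel T)) : measurable S -> measurable ((a ^~ x) @^-1` S).
Proof. by move=> mS; rewrite -[X in measurable X]setTI; exact: mA. Qed.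

Let kap_ge0 x S : (0 <= kap x S)%E.
Proof. by apply: integral_ge0 => v _; rewrite lee_fin mulr_ge0. Qed.

Let kapC x (S : set (borel T)) : measurable S -> (kap x S + kap x (~` S) = 1)%E.
Proof.
move=> mS; have mSC := measurableC mS.
rewrite !kap_setE// -ge0_integral_setU//.
- by rewrite preimage_setC setUv w1.
- exact: m_pre.
- exact: m_pre.
- by rewrite preimage_setC setUv; exact/measurable_EFinP.
- by move=> v _; rewrite lee_fin.
- by apply/disj_setPS; rewrite preimage_setC setICr.
Qed.

Let kap_fin x (S : set (borel T)) : measurable S -> kap x S \is a fin_num.
Proof.
move=> mS; rewrite ge0_fin_numE ?kap_ge0//.
apply: (@le_lt_trans _ _ 1%E); last exact: ltry.
by rewrite -(kapC x mS) leeDl.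
Qed.

Let kap_bigcup x (F : (set (borel T))^nat) : (forall n, measurable (F n)) ->
  trivIset setT F -> kap x (\bigcup_n F n) = (\sum_(n <oo) kap x (F n))%E.
Proof.
move=> mF tF; rewrite kap_setE; last exact: bigcupT_measurable.
rewrite preimage_bigcup ge0_integral_bigcup//.
- by apply: eq_eseriesr => n _; rewrite kap_setE.
- by move=> n; exact: m_pre.
- exact/measurable_EFinP/measurable_funTS.
- by move=> v _; rewrite lee_fin.
- apply/trivIsetP => i j _ _ ij; rewrite -preimage_setI.
  by rewrite (trivIsetP.1 tF)// preimage_set0.
Qed.

Let lip_below_cvg (U : set T) x : open U ->
  (lip_below U n x)%:E @[n --> \oo] --> ((\1_U x)%:E : \bar R).
Proof.
move=> oU; apply: cvg_near_cst.
have [Ux|Ux] := pselect (U x).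
  have [N UN] := lip_below_eq1 oU Ux; exists N => // n /= Nn.
  by rewrite UN// indicE mem_set.
apply: nearW => n; congr EFin; apply/eqP.
rewrite eq_le lip_below_le indicE memNset//= mulr0n.
exact: lip_below_ge0.
Qed.

Let cvg_kap (U : set T) x : open U ->
  (Pi (lip_below U n) x)%:E @[n --> \oo] --> kap x U.
Proof.
move=> oU; rewrite (_ : (fun n => _) = fun n =>
    (\int[mu]_v (lip_below U n (a v x) * w v x)%:E)%E); last first.
  by apply/funext => n; rewrite PiE//; exact: lip_lip_below.
apply: cvg_integral_nondecreasing.
- move=> n; apply/measurable_EFinP; apply: m_fw.
  by apply: lip_measurable; exact: lip_lip_below.
- by move=> n v; rewrite lee_fin mulr_ge0 ?lip_below_ge0.
- by move=> v m n mn; rewrite lee_fin ler_wpM2r// lip_below_nondecreasing.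
- move=> v; rewrite EFinM; under eq_fun do rewrite EFinM.
  by apply: cvgeZr => //; exact: lip_below_cvg.
Qed.

(** Monotone convergence presents [kap ^~ U] as a pointwise limit of the Lipschitz functions Pi
    (lip_below U n). *)
Let m_kap_open (U : set T) : open U ->
  measurable_fun [set: borel T] (kap ^~ U : borel T -> \bar R).
Proof.
move=> oU; apply: (@emeasurable_fun_cvg _ (borel T) R setT (fun n x => (Pi (lip_below U n) x)%:E)).
  by move=> n; apply/measurable_EFinP; exact: (lip_measurable (Pi_lip (lip_lip_below U n))).
by move=> x _; exact: cvg_kap.
Qed.

Theorem weighted_system_invariant : exists nu : probability (borel T) R,
  forall S : set (borel T), measurable S -> (\int[nu]_x kap x S = nu S)%E.
Proof.
have [nu nuE] := krylov_bogoliubov cT Pi_lip PiD PiZ Pi_ge0 Pi1.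
exists nu => S mS.
suff [] : measurable_fun [set: borel T] (kap ^~ S : borel T -> \bar R) /\
  (\int[nu]_x kap x S = nu S)%E by [].
(* Measurability of the kernel in its base point is carried through the Dynkin induction together
   with invariance, since integrating the complement and countable unions requires it. *)
pose P (S : set (borel T)) :=
  measurable_fun [set: borel T] (kap ^~ S : borel T -> \bar R) /\
  (\int[nu]_x kap x S = nu S)%E.
have Popen (U : set T) : open U -> P U.
  move=> oU; split; first exact: m_kap_open.
  have lb01 n x : 0 <= lip_below U n x <= 1.
    rewrite lip_below_ge0/=; apply: le_trans (lip_below_le _ _ _) _.
    by rewrite indicE lern1 leq_b1.
  have c1 : (\int[nu]_x (Pi (lip_below U n) x)%:E)%E @[n --> \oo] -->
      (\int[nu]_x kap x U)%E.
    apply: cvg_integral_nondecreasing.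
    - by move=> n; apply/measurable_EFinP; exact: (lip_measurable (Pi_lip (lip_lip_below U n))).
    - by move=> n x; rewrite lee_fin Pi_ge0//; [exact: lip_lip_below|exact: lip_below_ge0].
    - move=> x m n mn; rewrite lee_fin le_Pi//; try exact: lip_lip_below.
      by move=> y; exact: lip_below_nondecreasing.
    - by move=> x; exact: cvg_kap.
  have c2 : (\int[nu]_x (lip_below U n x)%:E)%E @[n --> \oo] --> nu U.
    rewrite -[X in nu X]setIT -integral_indic//; last exact: open_borel.
    apply: cvg_integral_nondecreasing.
    - by move=> n; apply/measurable_EFinP; exact: (lip_measurable (lip_lip_below U n)).
    - by move=> n x; rewrite lee_fin lip_below_ge0.
    - by move=> x m n mn; rewrite lee_fin lip_below_nondecreasing.
    - by move=> x; exact: lip_below_cvg.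
  move: c1; rewrite (_ : (fun n => _) = fun n => \int[nu]_x (lip_below U n x)%:E)%E.
    by move=> c1; exact: cvg_unique c1 c2.
  by apply/funext => n; rewrite nuE//; exact: lip_lip_below.
apply: (@dynkin_induction _ (borel T) open P) => //.
- by move=> A B; exact: openI.
- exact/Popen/openT.
- move=> A mA' [mkA IA].
  have kC x : kap x (~` A) = (1 - kap x A)%E.
    by rewrite -(kapC x mA') addeAC subee ?add0e ?kap_fin.
  have mkC : measurable_fun [set: borel T] (kap ^~ (~` A) : borel T -> \bar R).
    under eq_fun do rewrite kC.
    exact: emeasurable_funB.
  split => //.
  have : (\int[nu]_x (kap x A + kap x (~` A)) = 1)%E.
    under eq_integral do rewrite kapC//.
    by rewrite integral_cst//= mul1e probability_setT.
  rewrite ge0_integralD// IA probability_setC// => <-.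
  by rewrite addeAC subee ?add0e// fin_num_measure.
- move=> F mF tF PF; split.
    under eq_fun do rewrite kap_bigcup//.
    apply: ge0_emeasurable_sum => //= k _; exact: (PF k).1.
  under eq_integral do rewrite kap_bigcup//.
  rewrite integral_nneseries//; last by move=> n; exact: (PF n).1.
  rewrite measure_semi_bigcup//; last exact: bigcupT_measurable.
  by apply: eq_eseriesr => n _; exact: (PF n).2.
Qed.

End weighted_system.

(** * Hilbert-Schmidt norm and projective space *)

(** Joins the metric and the base point of [projective] into a [pmetricType]. *)
HB.instance Definition _ (R : realType) k := Pointed.on (projective R k).

Section hilbert_schmidt.
Context {R : realType}.
Local Notation C := (Cplx R).
Local Open Scope sesquilinear_scope.

Lemma sqr_modulus (z : C) : modulus z ^+ 2 = complex.Re z ^+ 2 + complex.Im z ^+ 2.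
Proof.
by rewrite /modulus normc_def /= sqr_sqrtr// addr_ge0 ?sqr_ge0.
Qed.

Lemma modulus_ge0 (z : C) : 0 <= modulus z.
Proof. by rewrite Re_ge0. Qed.

Lemma modulus_real (r : R) : 0 <= r -> modulus (real_complex R r) = r.
Proof. by move=> r0; rewrite /modulus ger0_norm ?ler0c. Qed.

Lemma modulusM (z t : C) : modulus (z * t) = modulus z * modulus t.
Proof. by apply: complexI; rewrite rmorphM /= !modulusE normrM. Qed.

Lemma modulus_conj (z : C) : modulus z^* = modulus z.
Proof. by rewrite /modulus norm_conjC. Qed.

Lemma modulus_eq0 (z : C) : modulus z = 0 -> z = 0.
Proof. by move=> z0; apply/eqP; rewrite -normr_eq0 -modulusE z0. Qed.

Lemma normr_Re_le (z : C) : `|complex.Re z| <= modulus z.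
Proof.
rewrite -ler_sqr ?nnegrE ?modulus_ge0// real_normK ?num_real// sqr_modulus.
by rewrite lerDl sqr_ge0.
Qed.

Lemma normr_Im_le (z : C) : `|complex.Im z| <= modulus z.
Proof.
rewrite -ler_sqr ?nnegrE ?modulus_ge0// real_normK ?num_real// sqr_modulus.
by rewrite lerDr sqr_ge0.
Qed.

Lemma sqr_hsnorm_sum m n (A : 'M[C]_(m, n)) :
  hsnorm A ^+ 2 = \sum_i \sum_j modulus (A i j) ^+ 2.
Proof.
apply: complexI; rewrite sqr_hsnorm rmorph_sum; apply: eq_bigr => i _.
rewrite mxE rmorph_sum; apply: eq_bigr => j _ /=.
by rewrite !mxE rmorphXn /= modulusE normCK.
Qed.

Lemma modulus_le_hsnorm m n (A : 'M[C]_(m, n)) i j : modulus (A i j) <= hsnorm A.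
Proof.
rewrite -ler_sqr ?nnegrE ?modulus_ge0 ?hsnorm_ge0// sqr_hsnorm_sum.
rewrite (bigD1 i)//= (bigD1 j)//= -addrA lerDl.
by rewrite addr_ge0// sumr_ge0// => a _; do ?[apply: sumr_ge0 => b _]; exact: sqr_ge0.
Qed.

Lemma hsnorm_tr m n (A : 'M[C]_(m, n)) : hsnorm (A ^t*) = hsnorm A.
Proof.
apply/eqP; rewrite -(@eqrXn2 _ 2) ?hsnorm_ge0//; apply/eqP.
rewrite !sqr_hsnorm_sum exchange_big; apply: eq_bigr => i _; apply: eq_bigr => j _.
by rewrite !mxE modulus_conj.
Qed.

Lemma hsnormN m n (A : 'M[C]_(m, n)) : hsnorm (- A) = hsnorm A.
Proof. by rewrite -scaleN1r hsnormZ /modulus normrN1 mul1r. Qed.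

Lemma hsnorm_distC m n (A B : 'M[C]_(m, n)) : hsnorm (A - B) = hsnorm (B - A).
Proof. by rewrite -hsnormN opprB. Qed.

Lemma ler_hsnormB m n (A B : 'M[C]_(m, n)) : hsnorm A - hsnorm B <= hsnorm (A - B).
Proof. by rewrite lerBlDr -{1}(subrK B A) ler_hsnormD. Qed.

Lemma hsnorm_le_bound m n (A : 'M[C]_(m, n)) e : 0 <= e ->
  (forall i j, modulus (A i j) <= e) -> hsnorm A <= (m * n)%:R * e.
Proof.
move=> e0 Ae; have mn0 : (0 : R) <= (m * n)%:R by [].
rewrite -ler_sqr ?nnegrE ?hsnorm_ge0 ?mulr_ge0// sqr_hsnorm_sum.
apply: (@le_trans _ _ (\sum_(i < m) \sum_(j < n) e ^+ 2)).
  apply: ler_sum => i _; apply: ler_sum => j _.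
  by rewrite ler_sqr ?nnegrE ?modulus_ge0.
rewrite !sumr_const !card_ord -mulrnA mulnC -[leLHS]mulr_natl exprMn ler_wpM2r ?sqr_ge0//.
by rewrite -natrX ler_nat; case: (m * n)%N => // p; rewrite expnS leq_pmulr.
Qed.

Lemma cdotBr n (x y z : 'cV[C]_n) : cdot x (y - z) = cdot x y - cdot x z.
Proof. by rewrite /cdot mulmxBr !mxE. Qed.

Lemma cdotZr n c (x y : 'cV[C]_n) : cdot x (c *: y) = c * cdot x y.
Proof. by rewrite /cdot -scalemxAr mxE. Qed.

Lemma cdotC n (x y : 'cV[C]_n) : cdot y x = (cdot x y)^*.
Proof. exact: conj_cdot. Qed.

(* Pythagoras for the decomposition of y along the line of the unit vector u.  *)
Lemma sqr_hsnorm_subZ n c (u y : 'cV[C]_n) : hsnorm u = 1 ->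
  hsnorm (y - c *: u) ^+ 2 =
  hsnorm y ^+ 2 - modulus (cdot u y) ^+ 2 + modulus (c - cdot u y) ^+ 2.
Proof.
move=> u1; apply: complexI.
rewrite -cdotxx rmorphD rmorphB /= -cdotxx !rmorphXn /= !modulusE !normCK.
rewrite cdotBr cdotZr [cdot _ y]cdotC [cdot _ u]cdotC !cdotBr !cdotZr !rmorphB !rmorphM /=.
have -> : cdot u u = 1 by rewrite cdotxx u1 expr1n.
rewrite rmorph1 -!cdotC; ring.
Qed.

(** Cauchy-Schwarz: the defect is the squared norm of the component of y orthogonal to u. *)
Lemma cdot_unit_le n (u y : 'cV[C]_n) : hsnorm u = 1 -> modulus (cdot u y) <= hsnorm y.
Proof.
move=> u1; rewrite -ler_sqr ?nnegrE ?modulus_ge0 ?hsnorm_ge0// -subr_ge0.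
rewrite (_ : _ - _ = hsnorm (y - cdot u y *: u) ^+ 2) ?sqr_ge0//.
by rewrite sqr_hsnorm_subZ// subrr [modulus 0]/modulus normr0 expr0n addr0.
Qed.

Lemma hsnorm_unitP n (x : 'cV[C]_n) : x != 0 ->
  exists2 u, hsnorm u = 1 & x = real_complex R (hsnorm x) *: u.
Proof.
move=> x0; have h0 : hsnorm x != 0 by apply: contra_neq x0 => /hsnorm_eq0.
exists (real_complex R (hsnorm x)^-1 *: x).
  by rewrite hsnormZ modulus_real ?invr_ge0 ?hsnorm_ge0// mulVf.
by rewrite scalerA -rmorphM divff// rmorph1 scale1r.
Qed.

(** After scaling x to a unit vector, Cauchy-Schwarz applies to each row of A. *)
Lemma hsnorm_mulmx_le m n (A : 'M[C]_(m, n)) (x : 'cV[C]_n) :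
  hsnorm (A *m x) <= hsnorm A * hsnorm x.
Proof.
have [->|] := eqVneq x 0; first by rewrite mulmx0 !hsnorm0 mulr0.
case/hsnorm_unitP => u u1; have := hsnorm_ge0 x; move: (hsnorm x) => c c0 ->.
rewrite -scalemxAr hsnormZ modulus_real// [leRHS]mulrC ler_wpM2l//.
rewrite -ler_sqr ?nnegrE ?hsnorm_ge0//.
rewrite !sqr_hsnorm_sum; apply: ler_sum => i _.
rewrite big_ord1.
have -> : \sum_j modulus (A i j) ^+ 2 = hsnorm ((row i A) ^t*) ^+ 2.
  rewrite sqr_hsnorm_sum; apply: eq_bigr => j _.
  by rewrite big_ord1 !mxE modulus_conj.
rewrite ler_sqr ?nnegrE ?modulus_ge0 ?hsnorm_ge0//.
apply: le_trans (cdot_unit_le _ u1); rewrite modulus_cdotC le_eqVlt; apply/orP; left.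
apply/eqP; congr modulus; rewrite /cdot trmxCK -row_mul.
by rewrite !mxE.
Qed.

End hilbert_schmidt.

(** * Metric and compactness of projective space *)

Section projective_geometry.
Context {R : realType} {k : nat}.
Local Notation C := (Cplx R).
Local Notation P := (projective R k).
Implicit Types (x y z : 'cV[C]_k.+1) (p q : P).

Lemma mdist_sqrE p q : mdist p q ^+ 2 = 1 - modulus (cdot (prepr p) (prepr q)) ^+ 2.
Proof.
rewrite [mdist p q]/(pdist p q) sqr_sqrtr// subr_ge0 expr_le1 ?modulus_ge0//.
by rewrite (le_trans (cdot_unit_le _ (prepr_norm p)))// prepr_norm.
Qed.

Lemma prepr_pclass x : x != 0 ->
  exists2 c, modulus c = hsnorm x & x = c *: prepr (pclass x).
Proof.
move=> x0; have : x \in <[prepr (pclass x)]>%VS.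
  by rewrite -val_prepr val_pclass// memv_line.
move=> /vlineP[c xc]; exists c => //.
by rewrite [in RHS]xc hsnormZ prepr_norm mulr1.
Qed.

Lemma pclassZ c x : c != 0 -> pclass (c *: x) = pclass x :> P.
Proof.
move=> c0; rewrite /pclass; congr insubd; apply/eqP.
rewrite eqEsubv -!memvE; apply/andP; split; first exact/memvZ/memv_line.
by rewrite -{1}[x](scalerK c0); exact/memvZ/memv_line.
Qed.

(** The left side is the distance from x to the line spanned by z, and z is one point of that
    line. *)
Lemma hsnorm_mdist x z : x != 0 -> z != 0 ->
  hsnorm x * mdist (pclass x : P) (pclass z) <= hsnorm (x - z).
Proof.
move=> x0 z0; have [c <- {2}->] := prepr_pclass x0; have [d _ {2}->] := prepr_pclass z0.
move: (pclass x) (pclass z) => p q.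
rewrite -ler_sqr ?nnegrE ?mulr_ge0 ?modulus_ge0 ?mdist_ge0 ?hsnorm_ge0//.
rewrite sqr_hsnorm_subZ ?prepr_norm// hsnormZ prepr_norm mulr1 cdotZr modulusM.
rewrite exprMn mdist_sqrE (modulus_cdotC (prepr p) (prepr q)) exprMn mulrBr mulr1.
by rewrite lerDl sqr_ge0.
Qed.

(** The representatives are arbitrary choices, so close lines may have distant ones. The phase c of
    their scalar product aligns them: with t its modulus, the squared distance becomes 2 (1 - t),
    and the squared distance of the lines is (1 - t)(1 + t) >= 1 - t. *)
Lemma prepr_phase p q : exists2 c, modulus c = 1 &
  hsnorm (prepr p - c *: prepr q) <= 2 * mdist p q.
Proof.
set x := prepr p; set y := prepr q.
set s := cdot y x; set t := modulus s.
have t0 : 0 <= t := modulus_ge0 s.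
have t1 : t <= 1 by rewrite -[leRHS](prepr_norm p) cdot_unit_le// prepr_norm.
have [c c1 sc] : exists2 c, modulus c = 1 & s = real_complex R t * c.
  have [s0|s0] := eqVneq s 0.
    exists 1; first by rewrite /modulus normr1.
    by rewrite /t s0 /modulus normr0 mul0r.
  have t0' : t != 0 by apply: contra_neq s0 => /modulus_eq0.
  exists (real_complex R t^-1 * s).
    by rewrite modulusM modulus_real ?invr_ge0// mulVf.
  by rewrite mulrA -rmorphM divff// mul1r.
exists c => //.
rewrite -ler_sqr ?nnegrE ?mulr_ge0 ?mdist_ge0 ?hsnorm_ge0//.
rewrite sqr_hsnorm_subZ ?prepr_norm// exprMn mdist_sqrE (modulus_cdotC y x) -/s -/t.
have -> : modulus (c - s) = 1 - t.
  rewrite sc -{1}[c]mul1r -mulrBl modulusM c1 mulr1.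
  by rewrite -(rmorph1 (real_complex R)) -rmorphB modulus_real// subr_ge0.
nra.
Qed.

(* A cluster point is produced coordinatewise: the real and imaginary parts of *)
(* the entries of the unit representatives are bounded, hence converge along   *)
(* any ultrafilter.                                                            *)
Lemma projective_compact : compact [set: P].
Proof.
rewrite compact_ultra => F FU _.
pose re i (p : P) := complex.Re (prepr p i ord0).
pose im i (p : P) := complex.Im (prepr p i ord0).
have entry_le i p : modulus (prepr p i ord0) <= 1.
  by rewrite -(prepr_norm p) modulus_le_hsnorm.
have cre i : cvg (re i @ F).
  by apply: (@bounded_ultra_cvg _ _ _ 1) => p; exact: le_trans (normr_Re_le _) (entry_le i p).
have cim i : cvg (im i @ F).
  by apply: (@bounded_ultra_cvg _ _ _ 1) => p; exact: le_trans (normr_Im_le _) (entry_le i p).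
pose y : 'cV[C]_k.+1 := \col_i (lim (re i @ F) +i* lim (im i @ F))%C.
have d0 : (hsnorm (prepr p - y)) ^+ 2 @[p --> F] --> (0 : R).
  rewrite (_ : (fun p => _) = fun p => \sum_i
      ((re i p - lim (re i @ F)) ^+ 2 + (im i p - lim (im i @ F)) ^+ 2)).
    have sq (u : P -> R) : cvg (u @ F) -> (u p - lim (u @ F)) ^+ 2 @[p --> F] --> (0 : R).
      move=> cu; rewrite -(mul0r 0); under eq_fun do rewrite expr2.
      have c0 : u p - lim (u @ F) @[p --> F] --> (0 : R) by exact/subr_cvg0.
      exact: cvgM.
    rewrite [X in _ --> X](_ : 0 = \sum_(i < k.+1) (0 + 0)); last by rewrite big1// addr0.
    apply: (cvg_big (@add_continuous R)) => i _.
    by apply: cvgD; exact: sq.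
  apply/funext => p; rewrite sqr_hsnorm_sum; apply: eq_bigr => i _.
  by rewrite big_ord1 sqr_modulus !mxE /re /im; case: (prepr p i ord0).
(* The limit vector is not 0, since some unit vector lies at distance less than 1 from it; hence it
   has a class. *)
have d1 : \forall p \near F, hsnorm (prepr p - y) ^+ 2 < 1.
  by apply: (cvgr_lt 0) => //.
have y0 : y != 0.
  have [p] := filter_ex d1; apply: contraTN => /eqP ->.
  by rewrite subr0 prepr_norm expr1n ltxx.
exists (pclass y); split=> //; apply/cvg_ballP => e e0.
have : \forall p \near F, hsnorm (prepr p - y) ^+ 2 < e ^+ 2.
  by apply: (cvgr_lt 0) => //; rewrite exprn_gt0.
apply: filterS => p; rewrite ltr_sqr ?nnegrE ?hsnorm_ge0 ?(ltW e0)// => pe.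
rewrite ballEmdist /= metric_sym; apply: le_lt_trans pe.
by have := hsnorm_mdist (prepr_neq0 p) y0; rewrite prepr_norm mul1r preprK.
Qed.

End projective_geometry.

(* Otherwise unification unfolds hsnorm down to square roots of traces.        *)
#[local] Opaque hsnorm.

(** * Functions with quadratic increments *)

Section quadratic.
Context {R : realType} {k : nat}.
Local Notation C := (Cplx R).
Local Notation M := 'M[C]_k.+1.
Local Open Scope sesquilinear_scope.

(* The local Lipschitz estimate of functions quadratic in the entries.         *)
Definition quad {m n} (g : 'M[C]_(m, n) -> R) := exists2 K, 0 <= K &
  forall A B, g A - g B <= K * (hsnorm A + hsnorm B) * hsnorm (A - B).

Lemma quad_open (g : M -> R) a : quad g -> open [set A : M | a < g A].
Proof.
move=> [K K0 gK]; rewrite openE => A /= ag.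
set n : R := (k.+1 * k.+1)%:R; have n1 : 1 <= n by rewrite ler1n.
have n0 : 0 <= n by rewrite (le_trans _ n1).
(* If the entries of A and B differ by less than e <= 1, then |A - B| <= n e and |B| <= |A| + n, so
   g A - g B <= (D - 1) e; the extra 1 leaves the strict margin e. *)
pose D := K * (2 * hsnorm A + n) * n + 1.
have D0 : 0 < D by rewrite ltr_wpDl// !mulr_ge0// addr_ge0// mulr_ge0// hsnorm_ge0.
pose e := Num.min 1 ((g A - a) / D).
have e0 : 0 < e by rewrite lt_min ltr01 divr_gt0// subr_gt0.
have e1 : e <= 1 by rewrite ge_min lexx.
have eD : e * D <= g A - a by rewrite -ler_pdivlMr// ge_min lexx orbT.
apply/nbhs_ballP; exists (real_complex R e); first by rewrite /= -(rmorph0 (real_complex R)) ltcR.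
move=> B [_ AB] /=.
have ABe : hsnorm (A - B) <= n * e.
  apply: hsnorm_le_bound; first exact: ltW.
  move=> i j; rewrite !mxE; have := AB i j; rewrite /ball /= => h.
  by rewrite -lecR modulusE ltW.
have B2 : hsnorm B <= hsnorm A + n.
  rewrite -lerBlDl (le_trans (ler_hsnormB _ _))// hsnorm_distC (le_trans ABe)//.
  by rewrite ler_piMr.
have : g A - g B <= K * (2 * hsnorm A + n) * (n * e).
  apply: le_trans (gK A B) _; apply: ler_pM => //.
  - by rewrite mulr_ge0// addr_ge0// hsnorm_ge0.
  - exact: hsnorm_ge0.
  - by rewrite ler_wpM2l// mulr_natl mulr2n -addrA lerD2l.
move=> gAB; rewrite -subr_gt0; apply: lt_le_trans e0 _.
rewrite (_ : g B - a = g A - a - (g A - g B)); last by ring.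
apply: le_trans (lerB eD gAB).
rewrite (_ : e * D - _ = e)//; rewrite /D; ring.

Qed.

Lemma quad_measurable (g : M -> R) : quad g ->
  measurable_fun [set: borel M] (g : borel M -> R).
Proof. by move=> qg; apply: lower_open_measurable => a; exact: quad_open. Qed.

Lemma quad_sqr_hsnorm m n : quad (fun A : 'M[C]_(m, n) => hsnorm A ^+ 2).
Proof.
exists 1 => // A B; rewrite mul1r subr_sqr mulrC ler_wpM2l ?addr_ge0 ?hsnorm_ge0//.
exact: ler_hsnormB.
Qed.

Lemma quad_mulmxr (g : 'cV[C]_k.+1 -> R) (x : 'cV[C]_k.+1) : quad g ->
  quad (fun A : M => g (A *m x)).
Proof.
move=> [K K0 gK]; exists (K * hsnorm x ^+ 2); first by rewrite mulr_ge0 ?sqr_ge0.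
move=> A B; apply: le_trans (gK _ _) _.
rewrite -mulmxBl.
have := hsnorm_mulmx_le A x; have := hsnorm_mulmx_le B x.
have := hsnorm_mulmx_le (A - B) x.
have := hsnorm_ge0 (A *m x); have := hsnorm_ge0 (B *m x).
have := hsnorm_ge0 ((A - B) *m x); have := hsnorm_ge0 x.
move: (hsnorm (A *m x)) (hsnorm (B *m x)) (hsnorm ((A - B) *m x)).
move: (hsnorm A) (hsnorm B) (hsnorm (A - B)) (hsnorm x).

move=> a' b' c' r a b c r0 c0 b0 a0 cc bb aa.
have -> : K * r ^+ 2 * (a' + b') * c' = K * ((a' * r + b' * r) * (c' * r)) by ring.
rewrite -mulrA ler_wpM2l//.
by apply: ler_pM => //; [exact: addr_ge0|exact: lerD].
Qed.

End quadratic.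

(** * Homogeneous lifts and measurability of the action *)

Section cone.
Context {R : realType} {k : nat}.
Local Notation C := (Cplx R).
Local Notation M := 'M[C]_k.+1.
Local Notation P := (projective R k).
Implicit Types (f : P -> R) (x y z : 'cV[C]_k.+1).

(** The integrand of the transfer operator is [cone f] at [L v *m x]. It vanishes at 0 whatever
    [pclass 0] is. *)
Definition cone f y := f (pclass y) * hsnorm y ^+ 2.

Lemma coneZ f c y : modulus c = 1 -> cone f (c *: y) = cone f y.
Proof.
move=> c1; rewrite /cone hsnormZ c1 mul1r pclassZ//.
by apply/eqP => c0; move: c1; rewrite c0 /modulus normr0 => /eqP; rewrite eq_sym oner_eq0.
Qed.

(** With F, G the values of f and s, t the norms, split F s^2 - G t^2 as (F - G) s^2 + G (s^2 -
    t^2). In the first term one factor s absorbs the projective distance by [hsnorm_mdist]; the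
    second uses the bound on f. Zero vectors are treated apart, as their class carries no metric
    information. *)
Lemma quad_cone f : lip f -> quad (cone f).
Proof.
move=> lf; have [N fN] := lip_bounded projective_compact lf.
have [K K0 fK] := lip_ge0 lf.
have N0 : 0 <= N := le_trans (normr_ge0 _) (fN point).
exists (K + N) => [|y z]; first exact: addr_ge0.
rewrite /cone.
have [->|y0] := eqVneq y 0.
  rewrite sub0r hsnormN hsnorm0.
  have := fN (pclass z); rewrite ler_norml => /andP[+ _].
  have := hsnorm_ge0 z.
  move: (f (pclass 0)) (f (pclass z)) (hsnorm z) => F G t t0 GN.
  have := mulr_ge0 K0 (sqr_ge0 t).
  have : 0 <= (G + N) * t ^+ 2 by rewrite mulr_ge0 ?sqr_ge0// -lerBlDr sub0r.
  lra.
have [->|z0] := eqVneq z 0.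
  rewrite subr0 hsnorm0.
  have := fN (pclass y); rewrite ler_norml => /andP[_].
  have := hsnorm_ge0 y.
  move: (f (pclass y)) (f (pclass 0)) (hsnorm y) => F G t t0 FN.
  have := mulr_ge0 K0 (sqr_ge0 t).
  have : 0 <= (N - F) * t ^+ 2 by rewrite mulr_ge0 ?sqr_ge0// subr_ge0.
  lra.
have := fN (pclass z); have := fK (pclass y) (pclass z).
have := hsnorm_mdist y0 z0; have := mdist_ge0 (pclass y : P) (pclass z).
have := ler_hsnormB z y; have := ler_hsnormB y z; rewrite (hsnorm_distC z).
have := hsnorm_ge0 z; have := hsnorm_ge0 y; have := hsnorm_ge0 (y - z).
move: (mdist _ _) (f (pclass y)) (f (pclass z)) (hsnorm (y - z)) (hsnorm y) (hsnorm z).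
move=> d F G r s t r0 s0 t0 st ts d0 sd FG GN.
have FGs : (F - G) * s ^+ 2 <= K * (s * r).
  apply: (@le_trans _ _ (K * d * s ^+ 2)); first by rewrite ler_wpM2r ?sqr_ge0.
  by rewrite -mulrA ler_wpM2l// mulrC expr2 -mulrA ler_wpM2l.
have Gst : G * (s ^+ 2 - t ^+ 2) <= N * (r * (s + t)).
  apply: le_trans (ler_norm _) _; rewrite normrM ler_pM//.
  rewrite subr_sqr normrM [`|s + t|]ger0_norm ?addr_ge0// ler_wpM2r ?addr_ge0//.
  by rewrite ler_norml lerNl opprB ts st.
rewrite (_ : F * s ^+ 2 - G * t ^+ 2 =
  (F - G) * s ^+ 2 + G * (s ^+ 2 - t ^+ 2)); last by ring.
apply: le_trans (lerD FGs Gst) _.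
rewrite (_ : (K + N) * (s + t) * r =
  K * (s * r) + N * (r * (s + t)) + K * (t * r)); last by ring.
by rewrite lerDl !mulr_ge0.
Qed.

(** Where A x is nonzero, the preimage of an open U is the union of the open sets on which the cone
    over an envelope of U is positive. Elsewhere the action takes the constant value [pclass 0], so
    the closed set A x = 0 is added or not according to whether U contains it. *)
Lemma pact_measurable p :
  measurable_fun [set: borel M] (fun A : borel M => pact (A : M) p : borel P).
Proof.
apply: (@measurability _ _ _ (borel P) _ _ open) => // _ [U oU <-].
rewrite setTI.
set x := prepr p.
have nz (A : M) : (A *m x != 0) = (0 < hsnorm (A *m x) ^+ 2).
  rewrite exprn_even_gt0//=; apply/idP/idP; apply: contra_neq.
    by move=> /hsnorm_eq0.
  by move=> ->; rewrite hsnorm0.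
pose Z := [set A : borel M | 0 < hsnorm ((A : M) *m x) ^+ 2].
have mZ : measurable Z.
  apply: sub_sigma_algebra; apply: (@quad_open _ _ (fun A : M => hsnorm (A *m x) ^+ 2)).
  by apply: (@quad_mulmxr _ _ (fun y => hsnorm y ^+ 2)); exact: quad_sqr_hsnorm.
pose W := \bigcup_n [set A : borel M | 0 < cone (lip_below U n) ((A : M) *m x)].
have mW : measurable W.
  apply: bigcupT_measurable => n; apply: sub_sigma_algebra.
  apply: (@quad_open _ _ (fun A : M => cone (lip_below U n) (A *m x))).
  by apply: quad_mulmxr; apply: quad_cone; exact: lip_lip_below.
have WE (A : M) : W A <-> Z A /\ U (pact A p).
  split=> [[n _ /=]|[ZA UA]].
    rewrite /cone => h; have ZA : Z A.
      rewrite /Z /= -nz; apply/eqP => A0; move: h.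
      by rewrite A0 hsnorm0 expr0n mulr0 ltxx.
    split => //; move: h; rewrite pmulr_lgt0// => /lt_le_trans/(_ (lip_below_le _ _ _)).
    by rewrite indicE ltr0n lt0b => /set_mem.
  have [N UN] := lip_below_eq1 oU UA; exists N => //=.
  by rewrite /cone UN// mul1r.
have [U0|U0] := pselect (U (pclass 0)).
  rewrite (_ : _ @^-1` _ = W `|` ~` Z); first by apply: measurableU => //; exact: measurableC.
  apply/seteqP; split=> A /=.
    by move=> UA; have [ZA|ZA] := pselect (Z A); [left; apply/WE|right].
  case=> [/WE[]//|/negP]; rewrite /Z /= -nz negbK => /eqP A0.
  by rewrite /pact A0.
rewrite (_ : _ @^-1` _ = W)//.
apply/seteqP; split=> A /=; last by case/WE.
move=> UA; apply/WE; split=> //; rewrite /Z /= -nz; apply/eqP => A0.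
by move: UA; rewrite /pact A0.
Qed.

End cone.

(** * The transfer operator of a stochastic map *)

Section gram.
Context {R : realType} {k : nat}.
Local Notation C := (Cplx R).
Local Notation M := 'M[C]_k.+1.
Local Open Scope sesquilinear_scope.

Lemma modulus_mulmx_le (A B : M) i j : modulus ((A *m B) i j) <= hsnorm A * hsnorm B.
Proof.
apply: (@le_trans _ _ (hsnorm (A *m col j B))).
  rewrite (_ : (A *m B) i j = (A *m col j B) i ord0) ?modulus_le_hsnorm//.
  by rewrite !mxE; apply: eq_bigr => a _; rewrite mxE.
apply: le_trans (hsnorm_mulmx_le _ _) _; rewrite ler_wpM2l ?hsnorm_ge0//.
rewrite -ler_sqr ?nnegrE ?hsnorm_ge0// !sqr_hsnorm_sum; apply: ler_sum => a _.
rewrite big_ord1 mxE (bigD1 j)//= lerDl sumr_ge0// => b _; exact: sqr_ge0.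
Qed.

(** Telescope the difference of Gram matrices through the product of the adjoint of A with B. The
    factor 1 matches the shape of [quad]. *)
Lemma gram_sub_le (A B : M) i j :
  modulus ((A ^t* *m A) i j - (B ^t* *m B) i j) <=
  1 * (hsnorm A + hsnorm B) * hsnorm (A - B).
Proof.
have -> : (A ^t* *m A) i j - (B ^t* *m B) i j =
    (A ^t* *m (A - B)) i j + ((A - B) ^t* *m B) i j.
  have DE (X Y : M) : X i j + Y i j = (X + Y) i j by rewrite mxE.
  have BE (X Y : M) : X i j - Y i j = (X - Y) i j by rewrite !mxE.
  rewrite DE BE mulmxBr [(A - B)^T]linearB /= map_mxB mulmxBl.
  by rewrite addrA subrK.
have modulusD (z t : C) : modulus (z + t) <= modulus z + modulus t.
  by rewrite -lecR rmorphD /= !modulusE ler_normD.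
apply: le_trans (modulusD _ _) _.
have := modulus_mulmx_le (A ^t* ) (A - B) i j.
have := modulus_mulmx_le ((A - B) ^t* ) B i j.
rewrite !hsnorm_tr; move: (hsnorm A) (hsnorm B) (hsnorm (A - B)) => a b c.
by move: (modulus _) (modulus _) => m m'; lra.
Qed.

Lemma quad_gram_Re i j : quad (fun A : M => complex.Re ((A ^t* *m A) i j)).
Proof.
exists 1 => // A B; apply: le_trans (gram_sub_le A B i j).
apply: le_trans (ler_norm _) _; apply: le_trans (normr_Re_le _).
by case: (_ i j) => a b; case: (_ i j) => c d.
Qed.

Lemma quad_gram_Im i j : quad (fun A : M => complex.Im ((A ^t* *m A) i j)).
Proof.
exists 1 => // A B; apply: le_trans (gram_sub_le A B i j).
apply: le_trans (ler_norm _) _; apply: le_trans (normr_Im_le _).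
by case: (_ i j) => a b; case: (_ i j) => c d.
Qed.

(** Makes |A x|^2 real-linear in the real and imaginary parts of the Gram entries, which
    [mxintegral] integrates separately. *)
Lemma sqr_hsnorm_gram (A : M) (x : 'cV[C]_k.+1) :
  hsnorm (A *m x) ^+ 2 = \sum_j \sum_i
    (complex.Re ((x i 0)^* * x j 0) * complex.Re ((A ^t* *m A) i j) -
     complex.Im ((x i 0)^* * x j 0) * complex.Im ((A ^t* *m A) i j)).
Proof.
have ReS (F : 'I_k.+1 -> C) : complex.Re (\sum_i F i) = \sum_i complex.Re (F i).
  by apply: (big_morph (@complex.Re R)) => // -[a b] [c d].
transitivity (complex.Re (cdot (A *m x) (A *m x))); first by rewrite cdotxx.
rewrite /cdot trmx_mul map_mxM mulmxA -(mulmxA (x ^t*)) mxE ReS.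
apply: eq_bigr => j _; rewrite mxE mulr_suml ReS; apply: eq_bigr => i _.
rewrite !mxE mulrAC.
by case: (_^* * _) => a b; case: (\sum_ _ _) => c d.
Qed.

End gram.

Lemma Rintegral_sum d {V : measurableType d} {R : realType}
    (mu : {measure set V -> \bar R}) I (s : seq I) (f : I -> V -> R) :
  (forall i, mu.-integrable setT (EFin \o f i)) ->
  \int[mu]_v (\sum_(i <- s) f i v) = \sum_(i <- s) \int[mu]_v f i v.
Proof.
move=> fi; elim: s => [|i s ih].
  by rewrite big_nil /Rintegral; under eq_integral do rewrite big_nil; rewrite integral0.
rewrite big_cons -ih -RintegralD//; first by apply: eq_Rintegral => v _; rewrite big_cons.
rewrite (_ : _ \o _ = fun v => (\sum_(i <- s) (f i v)%:E)%E).
  by apply: integrable_sum => // j _; exact: fi.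
by apply/funext => v; rewrite /= sumEFin.
Qed.

(** * Regularity and total mass of the transfer operator *)

Section stochastic_channel.
Context (R : realType) (k : nat).
Local Notation C := (Cplx R).
Local Notation M := 'M[C]_k.+1.
Local Notation P := (projective R k).
Local Open Scope sesquilinear_scope.
Variables (mu : {measure set (borel M) -> \bar R}) (L : borel M -> borel M).
Hypothesis L_meas : measurable_fun setT L.
Hypothesis L_sqint : (\int[mu]_v ((hsnorm (L v : M)) ^+ 2)%:E < +oo)%E.

Lemma quad_comp_measurable (g : M -> R) : quad g -> measurable_fun setT (fun v => g (L v)).
Proof. by move=> /quad_measurable mg; exact: (measurableT_comp mg L_meas). Qed.

Lemma sqr_hsnorm_integrable :
  mu.-integrable setT (EFin \o fun v => hsnorm (L v : M) ^+ 2).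
Proof.
apply/integrableP; split.
  by apply/measurable_EFinP; exact: (quad_comp_measurable (quad_sqr_hsnorm _ _)).
by under eq_integral => v _ do rewrite /= ger0_norm ?sqr_ge0//.
Qed.

(** Comparison with the zero matrix bounds |g A| by K |A|^2, and [L] has a finite second moment. *)
Lemma quad_integrable (g : M -> R) : quad g -> g 0 = 0 ->
  mu.-integrable setT (EFin \o fun v => g (L v)).
Proof.
move=> qg g0; have [K K0 gK] := qg.
apply: (@le_integrable _ _ _ _ _ _ _ (fun v => K%:E * (hsnorm (L v : M) ^+ 2)%:E)%E) => //.
- by apply/measurable_EFinP; exact: quad_comp_measurable.
- move=> v _; rewrite -EFinM /= lee_fin [leRHS]ger0_norm ?mulr_ge0 ?hsnorm_ge0//.
  rewrite expr2 mulrA.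
  have := gK (L v) 0; have := gK 0 (L v).
  rewrite g0 hsnorm0 !subr0 !sub0r hsnormN add0r addr0 => h1 h2.
  by rewrite ler_norml lerNl h1 h2.
- by apply: integrableZl => //; exact: sqr_hsnorm_integrable.
Qed.

Lemma cone_integrable (f : P -> R) y : lip f ->
  mu.-integrable setT (EFin \o fun v => cone f ((L v : M) *m y)).
Proof.
move=> lf; apply: (@quad_integrable (fun A : M => cone f (A *m y))).
  exact/quad_mulmxr/quad_cone.
by rewrite mul0mx /cone hsnorm0 expr0n mulr0.
Qed.

(** Defined on vectors rather than lines, so that the representative can be rotated by a phase. *)
Let transfer (f : P -> R) x := \int[mu]_v cone f ((L v : M) *m x).

Lemma transfer_phase f c x : modulus c = 1 -> transfer f (c *: x) = transfer f x.
Proof.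
by move=> c1; apply: eq_Rintegral => v _; rewrite -scalemxAr coneZ.
Qed.

Lemma transfer_sub_le f : lip f -> exists2 K, 0 <= K &
  forall x y, hsnorm x = 1 -> hsnorm y = 1 ->
  transfer f x - transfer f y <= K * hsnorm (x - y).
Proof.
move=> lf; have [K K0 fK] := quad_cone lf.
pose N := \int[mu]_v (hsnorm (L v : M) ^+ 2).
have N0 : 0 <= N by apply: Rintegral_ge0 => v _; exact: sqr_ge0.
exists (K * 2 * N) => [|x y x1 y1]; first by rewrite !mulr_ge0.
rewrite -RintegralB//; [|exact: cone_integrable..].
rewrite mulrAC -RintegralZl//; last exact: sqr_hsnorm_integrable.
apply: le_Rintegral => //.
- rewrite (_ : _ \o _ = fun v => ((cone f ((L v : M) *m x))%:E -
    (cone f ((L v : M) *m y))%:E)%E)//.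
  by apply: integrableB => //; exact: cone_integrable.
- rewrite (_ : _ \o _ = fun v =>
    ((K * 2 * hsnorm (x - y))%:E * (hsnorm (L v : M) ^+ 2)%:E)%E)//.
  by apply: integrableZl => //; exact: sqr_hsnorm_integrable.
- move=> v _; apply: le_trans (fK _ _) _; rewrite -mulmxBr.
  have := hsnorm_mulmx_le (L v : M) x; have := hsnorm_mulmx_le (L v : M) y.
  have := hsnorm_mulmx_le (L v : M) (x - y).
  have := hsnorm_ge0 ((L v : M) *m x); have := hsnorm_ge0 ((L v : M) *m y).
  have := hsnorm_ge0 ((L v : M) *m (x - y)); have := hsnorm_ge0 (L v : M).
  rewrite x1 y1 !mulr1.
  move: (hsnorm ((L v : M) *m x)) (hsnorm ((L v : M) *m y)).
  move: (hsnorm ((L v : M) *m (x - y))) (hsnorm (x - y)) (hsnorm (L v : M)).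
  move=> r e l a b l0 r0 b0 a0 re bl al.
  rewrite (_ : K * 2 * e * l ^+ 2 = K * (l + l) * (l * e)); last by ring.
  by rewrite ler_pM// ?mulr_ge0 ?addr_ge0// ler_wpM2l// lerD.
Qed.

(** Phase invariance replaces the representative of q by the one aligned with that of p; the factor
    2 comes from [prepr_phase]. *)
Lemma lip_transfer f : lip f -> lip (fun p => transfer f (prepr p)).
Proof.
move=> /transfer_sub_le[K K0 fK]; exists (K * 2) => p q /=.
have [c c1 pq] := prepr_phase p q.
rewrite -(transfer_phase f (prepr q) c1).
apply: le_trans (fK _ _ (prepr_norm p) _) _.
  by rewrite hsnormZ c1 prepr_norm mulr1.
by rewrite -mulrA ler_wpM2l.
Qed.

Hypothesis L_stoch : stochastic mu L.

Lemma channel_mass (x : 'cV[C]_k.+1) :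
  (\int[mu]_v (hsnorm ((L v : M) *m x) ^+ 2)%:E)%E = (hsnorm x ^+ 2)%:E.
Proof.
have gRe i j : mu.-integrable setT (EFin \o fun v => complex.Re (((L v : M) ^t* *m (L v : M)) i j)).
  apply: (quad_integrable (quad_gram_Re i j)).
  by rewrite mulmx0 mxE.
have gIm i j : mu.-integrable setT (EFin \o fun v => complex.Im (((L v : M) ^t* *m (L v : M)) i j)).
  apply: (quad_integrable (quad_gram_Im i j)).
  by rewrite mulmx0 mxE.
have x_int : mu.-integrable setT (EFin \o fun v => hsnorm ((L v : M) *m x) ^+ 2).
  apply: (@quad_integrable (fun A : M => hsnorm (A *m x) ^+ 2)).
    by apply: (@quad_mulmxr _ _ (fun y => hsnorm y ^+ 2)); exact: quad_sqr_hsnorm.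
  by rewrite mul0mx hsnorm0 expr0n.
rewrite -[LHS]fineK; last exact: integrable_fin_num.
congr EFin; rewrite -[LHS]/(\int[mu]_v hsnorm ((L v : M) *m x) ^+ 2).
(* The Gram expansion is used for [L v] and for the identity matrix; stochasticity says that the
   Gram entries of the first integrate to those of the second. *)
transitivity (hsnorm (1%:M *m x) ^+ 2); last by rewrite mul1mx.
rewrite [RHS]sqr_hsnorm_gram.
under eq_Rintegral do rewrite sqr_hsnorm_gram.
have stoch i j : (1%:M ^t* *m 1%:M : M) i j =
    mxintegral mu (fun v => (L v : M) ^t* *m (L v : M)) i j.
  by rewrite L_stoch mulmx1 trmx1 map_mx1.
have intZ a (g : borel M -> R) : mu.-integrable setT (EFin \o g) ->
    mu.-integrable setT (EFin \o fun v => a * g v).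
  by move=> ig; rewrite (_ : _ \o _ = fun v => (a%:E * (g v)%:E)%E)//; exact: integrableZl.
have cint a b i j : mu.-integrable setT (EFin \o fun v =>
    (a * complex.Re (((L v : M) ^t* *m (L v : M)) i j) -
     b * complex.Im (((L v : M) ^t* *m (L v : M)) i j))).
  rewrite (_ : _ \o _ = fun v =>
    ((a * complex.Re (((L v : M) ^t* *m (L v : M)) i j))%:E -
     (b * complex.Im (((L v : M) ^t* *m (L v : M)) i j))%:E)%E)//.
  by apply: integrableB => //; exact: intZ.
rewrite Rintegral_sum; last first.
  move=> j; rewrite (_ : _ \o _ = fun v => (\sum_i
    (complex.Re ((x i 0)^* * x j 0) * complex.Re (((L v : M) ^t* *m (L v : M)) i j) -
     complex.Im ((x i 0)^* * x j 0) * complex.Im (((L v : M) ^t* *m (L v : M)) i j))%:E)%E).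
    by apply: integrable_sum => // i _; exact: cint.
  by apply/funext => v; rewrite /= sumEFin.
apply: eq_bigr => j _; rewrite Rintegral_sum; last by move=> i; exact: cint.
apply: eq_bigr => i _; rewrite RintegralB//; [|exact: intZ..].
by rewrite !RintegralZl// stoch mxE.
Qed.

End stochastic_channel.

Theorem theorem5p2 (R : realType) (k : nat)
    (mu : {measure set (borel 'M[Cplx R]_k.+1) -> \bar R})
    (L : borel 'M[Cplx R]_k.+1 -> borel 'M[Cplx R]_k.+1)
    (L_meas : measurable_fun setT L)
    (L_sqint : (\int[mu]_v ((hsnorm (L v : 'M[Cplx R]_k.+1)) ^+ 2)%:E < +oo)%E)
    (L_irr : irreducible_map (channel mu L))
    (L_stoch : stochastic mu L) :
  exists nu : probability (borel (projective R k)) R,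
    forall S : set (borel (projective R k)), measurable S ->
      markov_push mu L nu S = nu S.
Proof.
apply: (weighted_system_invariant projective_compact
  (a := fun v p => pact (L v : 'M[Cplx R]_k.+1) p)
  (w := fun v p => hsnorm ((L v : 'M[Cplx R]_k.+1) *m prepr p) ^+ 2)).
- by move=> p; exact: (measurableT_comp (pact_measurable p) L_meas).
- move=> p; apply: (quad_comp_measurable L_meas
    (g := fun A : 'M[Cplx R]_k.+1 => hsnorm (A *m prepr p) ^+ 2)).
  by apply: (@quad_mulmxr _ _ (fun y => hsnorm y ^+ 2)); exact: quad_sqr_hsnorm.
- by move=> v p; exact: sqr_ge0.
- by move=> p; rewrite channel_mass// prepr_norm expr1n.
(* The operator of the weighted system is the transfer at [prepr p] by unfolding [cone] and
   [pact]. *)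
- by move=> f lf; exact: lip_transfer.
Qed.
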